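(* Let $M$ be a model of $T$ and $\bar a,\bar b$ finite tuples with $tp(\bar a\bar b/M)\in S_*(M)$. If $tp(\bar b/M\cup\bar a)$ is the stationarization of $tp(\bar b/M)$ over $M\cup\bar a$, then $tp(\bar a/M\cup\bar b)$ is the stationarization of $tp(\bar a/M)$ over $M\cup\bar b$.
   Context: Throughout, $T$ is a complete first-order theory in a language $L(T)$ without function symbols, $T$ has quantifier elimination, and $P$ is a unary predicate of $L(T)$. $\mathcal{C}$ is the monster model of $T$; all sets are subsets of $\mathcal{C}$, all models are elementary submodels of $\mathcal{C}$, types are computed in $\mathcal{C}$. Standing hypotheses: (H1) every relation on $P^{\mathcal{C}}$ first-order definable in $\mathcal{C}$ is definable without parameters in $\mathcal{C}|_{P^{\mathcal{C}}}$; (H2) every type over $P^{\mathcal{C}}$ is definable; (H3) every model of $T$ is a stable set. Definitions: a set $A$ is complete if for every formula $\psi(\bar x,\bar y)$ and $\bar b\subseteq A$ with $\models(\exists\bar x\in P)\psi(\bar x,\bar b)$ there is $\bar a\subseteq P^{\mathcal{C}}\cap A$ with $\models\psi(\bar a,\bar b)$. $A\equiv B$ means $\mathrm{Th}(\mathcal{C}|_A)=\mathrm{Th}(\mathcal{C}|_B)$ for the induced $L(T)$-structures. For complete $A$, $S_*(A)$ is the set of types $tp(\bar c/A)$ with $P^{\mathcal{C}}\cap(A\cup\bar c)=P^{\mathcal{C}}\cap A$ and $A\cup\bar c$ complete. $A$ is stable if it is complete and $|S_*(A')|\le|A'|^{|T|}$ for every $A'\equiv A$. For a type $p$ over $D$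 and a formula $\psi(\bar x,\bar y)$, $p|_\psi$ is the set of formulas $\pm\psi(\bar x,\bar b)\in p$; $\Psi(\bar y,\bar a)$ defines $p|_\psi$ if for all $\bar b\subseteq D$, $\psi(\bar x,\bar b)\in p$ iff $\models\Psi(\bar b,\bar a)$. $A\subseteq_t B$ means $A\subseteq B$ and whenever $\bar a\subseteq A$, $\bar b\subseteq B$ and $\models\psi(\bar b,\bar a)$, there is $\bar b'\subseteq A$ with $\models\psi(\bar b',\bar a)$; every model $M$ satisfies $M\subseteq_t B$ for all $B\supseteq M$. If $A$ is stable, $p\in S_*(A)$, $A\subseteq_t B$, then $q\in S(B)$ is a stationarization of $p$ over $B$ if for every $\psi(\bar x,\bar y)\in L(T)$ some formula $\Psi_\psi(\bar y,\bar a_\psi)$ with $\bar a_\psi\subseteq A$ defines both $p|_\psi$ and $q|_\psi$; it exists and is unique (the stationarization). *)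

(* Defs.v *)
From mathcomp Require Import all_boot.
From mathcomp Require Import boolp classical_sets functions cardinality.

Set Implicit Arguments.
Unset Strict Implicit.
Unset Printing Implicit Defensive.

Local Open Scope classical_set_scope.
Local Open Scope card_scope.

(* Relational languages, with equality as a logical symbol. *)
Record language := Language { rel_sym : Type; arity : rel_sym -> nat }.

(* [formula L n]: formulas whose free variables are among x_0, ..., x_(n-1).
   De Bruijn: [All] binds variable 0 of its body. *)
Inductive formula (L : language) : nat -> Type :=
| Bot n : formula L n
| Eq n (i j : 'I_n) : formula L n
| Rel n (R : rel_sym L) (x : (arity R).-tuple 'I_n) : formula L n
| Imp n (phi psi : formula L n) : formula L n
| All n (phi : formula L n.+1) : formula L n.

Fixpoint quantifier_free (L : language) n (phi : formula L n) : Prop :=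
  match phi with
  | Bot _ | Eq _ _ _ | Rel _ _ _ => True
  | Imp _ phi psi => quantifier_free phi /\ quantifier_free psi
  | All _ _ => False
  end.

(* Carriers may be empty, so that every subset of a structure carries an
   induced structure. *)
Record structure (L : language) := Structure {
  carrier :> Type;
  interp : forall R : rel_sym L, (arity R).-tuple carrier -> Prop
}.

Fixpoint sat (L : language) (N : structure L) n (phi : formula L n) :
    n.-tuple N -> Prop :=
  match phi in formula _ n return n.-tuple N -> Prop with
  | Bot _ => fun _ => False
  | Eq _ i j => fun v => tnth v i = tnth v j
  | Rel _ R x => fun v => interp (map_tuple (tnth v) x)
  | Imp _ phi psi => fun v => sat phi v -> sat psi v
  | All _ phi => fun v => forall x : N, sat phi (cons_tuple x v)
  end.

Definition sentence (L : language) := formula L 0.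

Definition holds (L : language) (N : structure L) (s : sentence L) : Prop :=
  sat s ([tuple] : 0.-tuple N).

Definition models (L : language) (N : structure L) (T : set (sentence L)) :=
  forall s, T s -> holds N s.

Definition entails (L : language) (T : set (sentence L)) (s : sentence L) :=
  forall N : structure L, models N T -> holds N s.

Definition complete_theory (L : language) (T : set (sentence L)) :=
  (exists N : structure L, models N T) /\
  forall s, entails T s \/ entails T (Imp s (Bot L 0)).

Definition quantifier_elimination (L : language) (T : set (sentence L)) :=
  forall n (phi : formula L n), exists2 psi : formula L n,
    quantifier_free psi &
    forall N : structure L, models N T ->
      forall v : n.-tuple N, sat phi v <-> sat psi v.

Definition induced (L : language) (N : structure L) (A : set N) : structure L :=
  @Structure L (set_type A) (fun R v => interp (map_tuple val v)).

Definition elementarily_equivalent (L : language) (N N' : structure L) :=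
  forall s : sentence L, holds N s <-> holds N' s.

Definition elementary_submodel (L : language) (C : structure L) (M : set C) :=
  forall n (phi : formula L n) (v : n.-tuple (induced M)),
    sat phi v <-> sat phi (map_tuple val v : n.-tuple C).

Definition automorphism (L : language) (C : structure L) (g : C -> C) :=
  bijective g /\
  forall (R : rel_sym L) (v : (arity R).-tuple C),
    interp v <-> interp (map_tuple g v).

(* [a] is a tuple from [A]. *)
Definition tuple_in (U : Type) n (a : n.-tuple U) (A : set U) :=
  range (tnth a) `<=` A.

Definition card_lt (U V : Type) (A : set U) (B : set V) : Prop :=
  (A #<= B) /\ ~ (B #<= A).

(* The cardinal of the type [K] is called kappa. *)
Definition small (K U : Type) (A : set U) := card_lt A [set: K].

(* kappa is strongly inaccessible and greater than |T|, the number of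
   L-formulas (in particular it is uncountable). *)
Definition inaccessible_above (L : language) (K : Type) :=
  [/\ small K [set: {n & formula L n}],
      forall X : set K, small K X -> small K [set Y | Y `<=` X]
    & forall (I : set K) (F : K -> set K), small K I ->
        (forall i, I i -> small K (F i)) -> small K (\bigcup_(i in I) F i)].

(* [PFormula psi b] is the formula psi(x, b), where x is an n-tuple of
   variables and the parameters b are substituted for the last variables. *)
Record pformula (L : language) (C : structure L) (n : nat) := PFormula {
  pf_size : nat;
  pf_body : formula L (n + pf_size);
  pf_params : pf_size.-tuple C
}.

Definition psat (L : language) (C : structure L) n (f : pformula C n)
    (c : n.-tuple C) : Prop :=
  sat (pf_body f) (cat_tuple c (pf_params f)).

Definition saturated (L : language) (K : Type) (C : structure L) :=
  forall (A : set C) n (p : set (pformula C n)),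
    small K A ->
    (forall f, p f -> tuple_in (pf_params f) A) ->
    (forall q, finite_set q -> q `<=` p -> exists c, forall f, q f -> psat f c) ->
    exists c, forall f, p f -> psat f c.

Definition strongly_homogeneous (L : language) (K : Type) (C : structure L) :=
  forall (A : set C) (f : C -> C),
    small K A ->
    (forall n (phi : formula L n) (a : n.-tuple C), tuple_in a A ->
       sat phi a <-> sat phi (map_tuple f a)) ->
    exists2 g : C -> C, automorphism g & forall x, A x -> g x = f x.

(* The monster model: kappa-saturated and strongly kappa-homogeneous for an
   inaccessible kappa > |T|; the subsets under consideration are those of
   cardinality < kappa. *)
Definition monster_model (L : language) (T : set (sentence L)) (K : Type)
    (C : structure L) :=
  [/\ models C T, inaccessible_above L K, saturated K C
    & strongly_homogeneous K C].

Definition model_in (L : language) (K : Type) (C : structure L) (M : set C) :=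
  small K M /\ elementary_submodel M.

(* The set P^C.  [P] is meant to be unary: for [arity P = 1] the tuple
   [nseq_tuple (arity P) x] is the 1-tuple x. *)
Definition Pset (L : language) (P : rel_sym L) (C : structure L) : set C :=
  [set x | interp (nseq_tuple (arity P) x)].
Arguments Pset {L} P C _.

Definition ntype (L : language) (C : structure L) (n : nat) :=
  set (pformula C n).

Definition tp (L : language) (C : structure L) n (c : n.-tuple C) (A : set C) :
    ntype C n :=
  [set f | tuple_in (pf_params f) A /\ psat f c].

(* p is an n-type over A; types are computed in C. *)
Definition type_over (L : language) (C : structure L) (A : set C) n
    (p : ntype C n) :=
  exists c : n.-tuple C, p = tp c A.

(* Psi(y, a) defines the restriction to psi(x, y) of the type p over D. *)
Definition defines (L : language) (C : structure L) (D : set C) n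
    (p : ntype C n) k (psi : formula L (n + k)) (Psi : pformula C k) :=
  forall b : k.-tuple C, tuple_in b D -> (p (PFormula psi b) <-> psat Psi b).

Definition definable_type (L : language) (C : structure L) (D : set C) n
    (p : ntype C n) :=
  forall k (psi : formula L (n + k)), exists2 Psi : pformula C k,
    tuple_in (pf_params Psi) D & defines D p psi Psi.

Definition complete_set (L : language) (P : rel_sym L) (C : structure L)
    (A : set C) :=
  forall n k (psi : formula L (n + k)) (b : k.-tuple C), tuple_in b A ->
    (exists2 a : n.-tuple C, tuple_in a (Pset P C) & sat psi (cat_tuple a b)) ->
    exists2 a : n.-tuple C, tuple_in a (Pset P C `&` A) &
      sat psi (cat_tuple a b).

Definition S_star (L : language) (P : rel_sym L) (C : structure L) (A : set C) n
    (p : ntype C n) :=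
  exists c : n.-tuple C,
    [/\ p = tp c A,
        Pset P C `&` (A `|` range (tnth c)) = Pset P C `&` A
      & complete_set P (A `|` range (tnth c))].

(* The right-hand side of the cardinal inequality is the set of functions from
   the set of L-formulas to A', whose cardinality is |A'|^|T|; the left-hand
   side is the set of members of S_*(A') of all finite arities. *)
Definition stable_set (L : language) (P : rel_sym L) (K : Type)
    (C : structure L) (A : set C) :=
  complete_set P A /\
  forall A' : set C, small K A' ->
    elementarily_equivalent (induced A') (induced A) ->
    [set p : {n & ntype C n} | S_star P A' (projT2 p)] #<=
    [set h : {n & formula L n} -> C | range h `<=` A'].

Definition subset_t (L : language) (C : structure L) (A B : set C) :=
  A `<=` B /\
  forall n k (psi : formula L (n + k)) (b : n.-tuple C) (a : k.-tuple C),
    tuple_in a A -> tuple_in b B -> sat psi (cat_tuple b a) ->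
    exists2 b' : n.-tuple C, tuple_in b' A & sat psi (cat_tuple b' a).

(* q is the stationarization of p in S_*(A) over B.  The conditions on A, p
   and B under which stationarizations are considered are part of the
   definition. *)
Definition stationarization (L : language) (P : rel_sym L) (K : Type)
    (C : structure L) (A B : set C) n (p q : ntype C n) :=
  [/\ stable_set P K A, S_star P A p, subset_t A B, type_over B q
    & forall k (psi : formula L (n + k)), exists Psi : pformula C k,
        [/\ tuple_in (pf_params Psi) A, defines A p psi Psi
          & defines B q psi Psi]].

(* Relations on P^C that are 0-definable in C are 0-definable in the induced
   structure on P^C. *)
Definition hypothesis_H1 (L : language) (P : rel_sym L) (C : structure L) :=
  forall n (phi : formula L n), exists psi : formula L n,
    forall v : n.-tuple (induced (Pset P C)),
      sat phi (map_tuple val v : n.-tuple C) <-> sat psi v.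

Definition hypothesis_H2 (L : language) (P : rel_sym L) (C : structure L) :=
  forall n (p : ntype C n), type_over (Pset P C) p ->
    definable_type (Pset P C) p.

Definition hypothesis_H3 (L : language) (P : rel_sym L) (K : Type)
    (C : structure L) :=
  forall M : set C, model_in K M -> stable_set P K M.

(* Main.v *)
(** By H2, the type of [c] over a model [N] lies in [S_*(N)] iff every trace on
    [P] of a formula with parameters in [N] and [c] is definable with parameters
    in [N].

    For a formula [ph x y], [rank w] is a finite-depth rank in which steps
    splitting a set by an instance of [ph] alternate with questions
    [exists z in P, psi z x nu], to be answered by an element of [P].  If all
    ranks were infinite, then along a long chain of sufficiently
    saturated sets with union a small model [N] one could build members of
    [S_*(N)], choosing at every stage between more extensions than there are
    functions from formulas to the current set; diagonalizing over these choices
    contradicts the bound H3 on [|S_*(N)|].  This replaces the usual tree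
    argument, which needs cardinals [lambda = lambda^{<lambda}].  Hence some rank
    is finite, and types in [S_*(N)] are definable over [N] as in stable
    theories.

    Suppose that [ph a b] holds, the type of [b] over [M] and [a] is definable
    over [M], but the definition of the type of [a] excludes [ph x b].  Then
    [theta x e] has rank at least [w], for every [w] and all [a], [e] such that
    [theta a e] holds and the type of [e] over [N] and [a] is definable over [N]:
    split by a realization [b'] of the definable extension of the type of [b]
    over [N] and [a], take a further realization of the type of [a] over a model
    [N'] containing [N], [a] and [b'], and let [e] be independent of all of them.
    To answer a question about [nu], one needs that [nu] can be chosen with [e nu]
    in [S_*(N)]; this is again a construction along a chain exhausting [N]. *)

Require Import Defs.
From Stdlib Require Import Eqdep_dec.
From mathcomp Require Import all_boot.
From mathcomp Require Import boolp classical_sets functions cardinality wochoice.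

Set Implicit Arguments.
Unset Strict Implicit.
Unset Printing Implicit Defensive.

Local Open Scope classical_set_scope.
Local Open Scope card_scope.

(** * Well-orders and small sets *)

(** H3 bounds only the types in [S_*(N)], and this shapes the rank: a type built from splittings
    alone need not be complete over [P], so the questions reserve in advance the room for witnesses
    from [P] inside [N]. The parameters [nu] of a question are quantified inside the rank; hence
    having rank at least [w] is a first-order condition without new parameters. Since a
    concatenation of words implies the conditions of its parts, compactness applies.

    The set [N] is fixed before the elements chosen in the construction are known. Each step
    therefore chooses them anywhere in the monster model and moves the whole family at once into the
    next set of the chain, which realizes the types of all such families over the previous one.
    Parameters [e] outside [N] obstruct this move; traces on [P] restore it, because answers are
    elements of [P].

    Every family indexed by formulas is bounded in the chain. Hence a function from formulas to [N],
    the code of a type given by H3, has its values in one set of the chain, and a single type that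
    avoids the codes of every stage is contradictory. *)

Fixpoint all_of (T : Type) (Q : T -> Prop) (l : seq T) : Prop :=
  if l is x :: l' then Q x /\ all_of Q l' else True.

Lemma all_of_cat (T : Type) (Q : T -> Prop) l l' :
  all_of Q (l ++ l') <-> all_of Q l /\ all_of Q l'.
Proof. by elim: l => [|x l IH] /=; tauto. Qed.

Lemma all_of_sub (T : Type) (Q Q' : T -> Prop) l :
  (forall x, Q x -> Q' x) -> all_of Q l -> all_of Q' l.
Proof. by move=> QQ'; elim: l => //= x l IH [/QQ' Qx /IH]. Qed.

Lemma all_of_map (T U : Type) (Q : U -> Prop) (f : T -> U) l :
  all_of Q (map f l) <-> all_of (Q \o f) l.
Proof. by elim: l => [|x l IH] /=; tauto. Qed.

Lemma all_of_true (T : Type) (Q : T -> Prop) l : (forall x, Q x) -> all_of Q l.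
Proof. by move=> Qx; elim: l. Qed.

Definition some_in (Y : Type) (y0 : Y) (P : Y -> Prop) : Y :=
  if pselect (exists y, P y) is left h then projT1 (cid h) else y0.

Lemma some_inP (Y : Type) (y0 : Y) (P : Y -> Prop) :
  (exists y, P y) -> P (some_in y0 P).
Proof. by rewrite /some_in; case: pselect => // h _; case: cid. Qed.

Section WellOrder.
Variable V : Type.

Record strict_wo (lt : V -> V -> Prop) : Prop := StrictWo {
  swo_wf : well_founded lt;
  swo_trans : forall u v w, lt u v -> lt v w -> lt u w;
  swo_total : forall u v, [\/ lt u v, u = v | lt v u] }.

Lemma strict_wo_exists : exists lt, strict_wo lt.
Proof.
have [R woR] := @well_ordering_principle {classic V}.
have woC : @wo_chain {classic V} R predT by move=> A _; exact: woR.
have tot u v : R u v || R v u := wo_chainW woC (isT : u \in predT) (isT : v \in predT).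
have refl u : R u u by have := tot u u; rewrite orbb.
have anti u v : R u v -> R v u -> u = v.
  move=> uv vu; apply: (wo_chain_antisymmetric woC) => //.
  exact/andP.
have min (A : set V) : A !=set0 -> exists2 z, A z & forall x, A x -> R z x.
  move=> [x Ax].
  have [|z [[Az zA] _]] := woR (fun x => `[< A x >]).
    by exists x; apply/asboolP.
  by exists z; [exact/asboolP | move=> y Ay; apply: zA; exact/asboolP].
exists (fun u v => R u v /\ u <> v); split.
- move=> v; apply: contrapT => nv.
  have [|z nz zmin] := min [set v | ~ Acc (fun u v => R u v /\ u <> v) v].
    by exists v.
  apply: nz; constructor=> y [yz ne]; apply: contrapT => ny; apply: ne.
  by apply: anti => //; exact: zmin.
- move=> u v w [uv nuv] [vw nvw]; split; last first.
    by move=> uw; rewrite -uw in vw; apply: nuv; exact: anti.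
  (* Transitivity comes from the least element of the set of these three points. *)
  have [z zin zmin] := min [set x | [\/ x = u, x = v | x = w]] (ex_intro _ u (Or31 _ _ erefl)).
  have zu := zmin u (Or31 _ _ erefl); have zv := zmin v (Or32 _ _ erefl).
  have zw := zmin w (Or33 _ _ erefl).
  case: zin zu zv zw => -> // zu zv zw.
    by case: nuv; exact: anti.
  by case: nvw; exact: anti.
- move=> u v; have [->|ne] := pselect (u = v); first exact: Or32.
  by have /orP[uv|vu] := tot u v; [apply: Or31 | apply: Or33; split=> // /esym].
Qed.

Variables (lt : V -> V -> Prop) (wo : strict_wo lt).

(** Transfinite recursion with choice. The first hypothesis says that the condition at [v] reads [g]
    only below [v], so the recursion may fill all other places with the default [y0]. *)
Lemma wf_rec_choice (Y : Type) (y0 : Y) (Q : V -> (V -> Y) -> Y -> Prop) :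
  (forall v g g' y, (forall u, lt u v -> g u = g' u) -> Q v g y -> Q v g' y) ->
  (forall v g, (forall u, lt u v -> Q u g (g u)) -> exists y, Q v g y) ->
  exists g, forall v, Q v g (g v).
Proof.
move=> Qloc Qex.
pose ext v (rec : forall u, lt u v -> Y) u : Y :=
  if pselect (lt u v) is left h then rec u h else y0.
pose F v rec : Y := some_in y0 (Q v (ext v rec)).
pose g : V -> Y := Fix (swo_wf wo) (fun _ => Y) F.
have gE v : g v = F v (fun u _ => g u).
  apply: (Fix_eq (swo_wf wo) (fun _ => Y)) => x f f' ff'; rewrite /F; congr (some_in y0 (Q x _)).
  by apply: funext => u; rewrite /ext; case: pselect => // h; rewrite ff'.
have extE v u : lt u v -> ext v (fun u _ => g u) u = g u by rewrite /ext; case: pselect.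
exists g; elim/(well_founded_ind (swo_wf wo)) => v IH.
apply: (Qloc _ _ _ _ (extE v)); rewrite gE /F; apply: some_inP; apply: Qex => u uv.
rewrite extE //; apply: Qloc (IH u uv) => w wu; rewrite extE //; exact: swo_trans uv.
Qed.
End WellOrder.

Definition inj_on (U U' : Type) (A : set U) (h : U -> U') :=
  forall x y, A x -> A y -> h x = h y -> x = y.

Lemma card_le_of_inj (U U' : Type) (A : set U) (B : set U') (h : U -> U') :
  (forall x, A x -> B (h x)) -> inj_on A h -> A #<= B.
Proof.
move=> AB hI; have [f] : $|{injfun A >-> B}|; last exact: inj_card_le.
by apply/injfunPex; exists h => // x y /set_mem Ax /set_mem Ay; exact: hI.
Qed.

Lemma card_le_fun (U U' : Type) (A : set U) (B : set U') : A #<= B ->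
  exists f : set_type A -> set_type B, injective f.
Proof.
move=> /card_leP /injfunPex[f _ fI]; exists f => x y; apply: fI; exact: in_setT.
Qed.

(** * Sets smaller than an inaccessible cardinal *)

Section Small.
Variable K : Type.

(* Equivalent to [small K A] by comparability of cardinals; the negative form
   is stable under unions without any choice of representatives. *)
Definition sm (U : Type) (A : set U) :=
  ~ exists2 f : K -> U, injective f & forall k, A (f k).

Lemma sm_inj (U U' : Type) (A : set U) (B : set U') (h : U -> U') :
  (forall x, A x -> B (h x)) -> inj_on A h -> sm B -> sm A.
Proof.
move=> AB hI nB [f fI fA]; apply: nB; exists (h \o f) => [k k' e|k]; last exact: AB.
by apply: fI; exact: hI.
Qed.

Lemma sm_sub (U : Type) (A B : set U) : A `<=` B -> sm B -> sm A.
Proof. by move=> AB; apply: (@sm_inj _ _ _ _ id). Qed.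

Lemma sm_image (U U' : Type) (A : set U) (h : U -> U') : sm A -> sm (h @` A).
Proof.
move=> nA [f fI fA]; apply: nA.
have fA2 k : exists x, A x /\ h x = f k by have [x Ax e] := fA k; exists x.
have [j jP] := choice fA2; exists j => [k k' e|k]; last by case: (jP k).
by apply: fI; rewrite -(proj2 (jP k)) -(proj2 (jP k')) e.
Qed.

Lemma sm_sig (U : Type) (A : set U) : sm A -> sm [set: {x | A x}].
Proof.
apply: (@sm_inj _ _ _ _ sval) => [[]//|[x Ax] [y Ay] _ _ /= e].
by apply: eq_exist.
Qed.

Lemma sm_inhabited (U : Type) (A : set U) : sm A -> exists k : K, True.
Proof.
move=> nA; apply: contrapT => nK; have nk (k : K) : False by apply: nK; exists k.
by apply: nA; exists (fun k => False_rect _ (nk k)) => k; case: (nk k).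
Qed.

Lemma sm_inj_card (U : Type) (A : set U) : sm A -> exists g : U -> K, inj_on A g.
Proof.
move=> nA; have [k0 _] := sm_inhabited nA; have [lt wo] := strict_wo_exists U.
have [|u g IH|g gP] := wf_rec_choice wo k0
    (Q := fun u g k => forall v, lt v u -> A v -> k <> g v).
- by move=> u g g' k gg' kP v vu Av; rewrite -gg' //; exact: kP.
- apply: contrapT => nk; apply: nA.
  have hit k : exists v, A v /\ k = g v.
    apply: contrapT => nv; apply: nk; exists k => v _ Av kv; apply: nv.
    by exists v.
  have [j jP] := choice hit; exists j => [k k' e|k]; last by case: (jP k).
  by rewrite (proj2 (jP k)) (proj2 (jP k')) e.
exists g => u v Au Av e; have [uv|//|vu] := swo_total wo u v.
- by case: (gP v u uv Au).
- by case: (gP u v vu Av).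
Qed.

Lemma sm_small (U : Type) (A : set U) : sm A -> small K A.
Proof.
move=> nA; have [g gI] := sm_inj_card nA; split.
  exact: card_le_of_inj gI.
move=> /card_le_fun[f fI]; apply: nA.
exists (fun k => val (f (SigSub (in_setT k)))); last first.
  by move=> k; apply: set_mem; exact: valP.
by move=> k k' /val_inj /fI [].
Qed.

Lemma small_sm (U : Type) (A : set U) : small K A -> sm A.
Proof.
move=> [_ nA] [f fI fA]; apply: nA; apply: (@card_le_of_inj _ _ _ _ f) => //.
by move=> k k' _ _; exact: fI.
Qed.

(** Inaccessibility with the language forgotten: all that is kept of the set of formulas is an
    infinite small type. *)
Definition strongly_inaccessible :=
  [/\ exists F : Type, (exists h : nat -> F, injective h) /\ sm [set: F],
      forall X : set K, small K X -> small K [set Y | Y `<=` X]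
    & forall (I : set K) (F : K -> set K), small K I ->
        (forall i, I i -> small K (F i)) -> small K (\bigcup_(i in I) F i)].

Hypothesis hK : strongly_inaccessible.

Lemma sm_pow (U : Type) (A : set U) : sm A -> sm [set Y | Y `<=` A].
Proof.
move=> nA; have [g gI] := sm_inj_card nA; have [_ hpow _] := hK.
have := small_sm (hpow _ (sm_small (sm_image (h := g) nA))).
apply: (sm_inj (h := fun Y => g @` Y)) => [Y YA _ [u Yu <-]|Y Y' YA YA' e].
  by exists u => //; exact: YA.
have sub Z Z' : Z `<=` A -> Z' `<=` A -> g @` Z = g @` Z' -> Z `<=` Z'.
  move=> ZA ZA' e' u Zu; have [u' Zu' /gI <-//] : (g @` Z') (g u) by rewrite -e'; exists u.
    exact: ZA'.
  exact: ZA.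
by apply/seteqP; split; apply: sub.
Qed.

(** Regularity is assumed for families inside [K] only. An embedding of [K] into the union cuts [K]
    into fibres, each embedded in some [F i]; indexing the fibres by representatives in [K] makes
    [K] a small union of small sets. *)
Lemma sm_bigcup (I U : Type) (J : set I) (F : I -> set U) : sm J ->
  (forall i, J i -> sm (F i)) -> sm (\bigcup_(i in J) F i).
Proof.
move=> nJ nF [f fI fU]; have [_ _ hcup] := hK.
have fU2 k : exists i, J i /\ F i (f k) by have [i] := fU k; exists i.
have [j jP] := choice fU2.
have jJ k : J (j k) by case: (jP k).
have jF k : F (j k) (f k) by case: (jP k).
pose rep k := some_in k (fun k' => j k' = j k).
have repP k : j (rep k) = j k by apply: (@some_inP _ k (fun k' => j k' = j k)); exists k.
have smI : sm (range rep).
  apply: (sm_inj (h := j) _ _ nJ) => [_ [k _ <-]|_ _ [k _ <-] [k' _ <-]]; first exact: jJ.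
  rewrite !repP /rep => ->.
  by rewrite /some_in; case: pselect => // h; case: h; exists k'.
have [] := hcup _ (fun k => [set k' | j k' = j k]) (sm_small smI).
  move=> k _; apply: sm_small; apply: (@sm_inj _ _ _ _ f) (nF _ (jJ k)).
    by move=> k' /= <-.
  by move=> x y _ _; exact: fI.
move=> _; apply; apply: subset_card_le => k _; exists (rep k); first by exists k.
by rewrite /= repP.
Qed.

Lemma sm_nat : sm [set: nat].
Proof.
have [[F [[h hI] nF]] _ _] := hK.
by apply: (@sm_inj _ _ _ _ h) nF => // x y _ _; exact: hI.
Qed.

Lemma sm_ord n (A : set 'I_n) : sm A.
Proof.
apply: (@sm_inj _ _ _ _ (@nat_of_ord n)) sm_nat => // x y _ _; exact: val_inj.
Qed.

Lemma sm_range_ord n (U : Type) (g : 'I_n -> U) : sm (range g).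
Proof. exact/sm_image/sm_ord. Qed.

Lemma sm0 (U : Type) : sm (@set0 U).
Proof.
by move=> [f _ f0]; have [[F [_ nF]] _ _] := hK; have [k _] := sm_inhabited nF; case: (f0 k).
Qed.

Lemma sm_setU (U : Type) (A B : set U) : sm A -> sm B -> sm (A `|` B).
Proof.
move=> nA nB.
apply: (@sm_sub _ _ (\bigcup_(b in [set: bool]) (if b then A else B))).
  by move=> u [Au|Bu]; [exists true | exists false].
apply: sm_bigcup => [|[]//]; apply: (@sm_inj _ _ _ _ nat_of_bool) sm_nat => //.
by move=> [] [].
Qed.

Lemma sm_prod (U W : Type) (A : set U) (B : set W) : sm A -> sm B -> sm (A `*` B).
Proof.
move=> nA nB; apply: (@sm_sub _ _ (\bigcup_(a in A) (pair a @` B))).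
  by move=> [a b] [/= Aa Bb]; exists a => //; exists b.
by apply: sm_bigcup => // a _; exact: sm_image.
Qed.

Lemma sm_fun (U W : Type) (B : set W) : sm [set: U] -> sm B ->
  sm [set h : U -> W | range h `<=` B].
Proof.
move=> nU nB; have := sm_pow (sm_prod nU nB).
apply: (@sm_inj _ _ _ _ (fun h => [set p | p.2 = h p.1])).
  by move=> h hB [u w] /= ->; split => //; apply: hB; exists u.
move=> h h' _ _ e; apply: funext => u.
by have : [set p | p.2 = h p.1] (u, h u) by []; rewrite e.
Qed.

End Small.

(** * Definable predicates *)

Definition fcons n (U : Type) (c : U) (g : 'I_n -> U) (i : 'I_n.+1) : U :=
  oapp g c (unlift ord0 i).

Lemma fcons0 n (U : Type) (c : U) (g : 'I_n -> U) : fcons c g ord0 = c.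
Proof. by rewrite /fcons unlift_none. Qed.

Lemma fconsS n (U : Type) (c : U) (g : 'I_n -> U) j : fcons c g (lift ord0 j) = g j.
Proof. by rewrite /fcons liftK. Qed.

Lemma fcons_eta (U : Type) n (h : 'I_n.+1 -> U) : fcons (h ord0) (h \o lift ord0) = h.
Proof. by apply: funext => i; rewrite /fcons; case: unliftP => [j|] ->. Qed.

Definition fcat (U : Type) n m (g : 'I_n -> U) (h : 'I_m -> U) (i : 'I_(n + m)) : U :=
  match fintype.split i with inl j => g j | inr j => h j end.

Lemma fcat_lshift (U : Type) n m (g : 'I_n -> U) (h : 'I_m -> U) i :
  fcat g h (lshift m i) = g i.
Proof. by rewrite /fcat -[lshift m i]/(unsplit (inl i)) unsplitK. Qed.

Lemma fcat_rshift (U : Type) n m (g : 'I_n -> U) (h : 'I_m -> U) i :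
  fcat g h (rshift n i) = h i.
Proof. by rewrite /fcat -[rshift n i]/(unsplit (inr i)) unsplitK. Qed.

Definition fsum (U V W : Type) (g : V -> U) (h : W -> U) (x : V + W) : U :=
  match x with inl v => g v | inr w => h w end.

Section Definability.
Variables (L : language) (C : structure L).

(** Assignments are functions instead of tuples, so that a change of variables is a composition. *)
Definition fsat n (phi : formula L n) (g : 'I_n -> C) : Prop :=
  sat phi [tuple g i | i < n].

Lemma sat_fsat n (phi : formula L n) (v : n.-tuple C) : sat phi v = fsat phi (tnth v).
Proof.
by rewrite /fsat; congr sat; apply: eq_from_tnth => i; rewrite tnth_mktuple.
Qed.

Lemma tnth_cons n (c : C) (v : n.-tuple C) : tnth (cons_tuple c v) = fcons c (tnth v).
Proof.
apply: funext => i; rewrite /fcons; case: unliftP => [j|] ->; last by [].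
by rewrite (tnth_nth c) /= -tnth_nth.
Qed.

Lemma tnth_cat n m (v : n.-tuple C) (w : m.-tuple C) :
  tnth (cat_tuple v w) = fcat (tnth v) (tnth w).
Proof.
apply: funext => i; rewrite -(splitK i) /fcat unsplitK; case: (fintype.split i) => j /=.
  by rewrite tnth_lshift.
by rewrite tnth_rshift.
Qed.

Lemma tnth_mktupleE n (g : 'I_n -> C) : tnth [tuple g i | i < n] = g.
Proof. by apply: funext => i; rewrite tnth_mktuple. Qed.

Lemma fsat_all n (phi : formula L n.+1) g :
  fsat (All phi) g <-> forall c, fsat phi (fcons c g).
Proof.
rewrite {1}/fsat /=; split=> h c.
  by have := h c; rewrite sat_fsat tnth_cons tnth_mktupleE.
by rewrite sat_fsat tnth_cons tnth_mktupleE.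
Qed.

Lemma fsat_eq n (i j : 'I_n) g : fsat (Eq L i j) g <-> g i = g j.
Proof. by rewrite /fsat /= !tnth_mktuple. Qed.

Definition liftr n m (r : 'I_n -> 'I_m) : 'I_n.+1 -> 'I_m.+1 :=
  fcons ord0 (lift ord0 \o r).

Fixpoint rename n (phi : formula L n) : forall m, ('I_n -> 'I_m) -> formula L m :=
  match phi in formula _ n return forall m, ('I_n -> 'I_m) -> formula L m with
  | Bot _ => fun m _ => Bot L m
  | Eq _ i j => fun m r => Eq L (r i) (r j)
  | Rel _ R x => fun m r => Rel (map_tuple r x)
  | Imp _ phi psi => fun m r => Imp (rename phi r) (rename psi r)
  | All _ phi => fun m r => All (rename phi (liftr r))
  end.

Lemma fsat_rename n (phi : formula L n) m (r : 'I_n -> 'I_m) g :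
  fsat (rename phi r) g <-> fsat phi (g \o r).
Proof.
elim: phi m r g => {n} [n|n i j|n R x|n phi IH1 psi IH2|n phi IH] m r g //=.
- by rewrite !fsat_eq.
- rewrite /fsat /=; set t := map_tuple _ _; set t' := map_tuple _ _.
  suff -> : t = t' by [].
  by apply: eq_from_tnth => i; rewrite !(tnth_map, tnth_mktuple).
- by rewrite /fsat /=; have := IH1 m r g; have := IH2 m r g; rewrite /fsat; tauto.
- have e c : fcons c g \o liftr r = fcons c (g \o r).
    apply: funext => i /=; case: (unliftP ord0 i) => [j|] ->.
      by rewrite /liftr !fconsS.
    by rewrite /liftr !fcons0.
  by rewrite !fsat_all; split=> h c; move: (h c); rewrite IH e.
Qed.

(* A formula whose variables are interpreted either as elements of [V], to be
   assigned later, or as parameters from [C]. *)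
Record code (V : Type) := Code {
  code_size : nat;
  code_body : formula L code_size;
  code_var : 'I_code_size -> V + C }.

Arguments code_body {V} c.
Arguments code_var {V} c i.

Definition csat V (k : code V) (g : V -> C) : Prop :=
  fsat (code_body k) (fsum g id \o code_var k).

Definition cpar V (k : code V) : set C := [set c | exists i, code_var k i = inr c].

(** Definability is a property of predicates, over a variable type [V] that may be infinite. With
    the closure properties below, later arguments use predicates and rarely touch syntax. *)
Definition dfn V (B : set C) (D : (V -> C) -> Prop) : Prop :=
  exists2 k : code V, cpar k `<=` B & forall g, D g <-> csat k g.

Lemma dfn_sub V (B B' : set C) (D : (V -> C) -> Prop) :
  B `<=` B' -> dfn B D -> dfn B' D.
Proof. by move=> BB' [k kB kD]; exists k => //; exact: subset_trans BB'. Qed.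

Lemma dfn_ext V (B : set C) (D D' : (V -> C) -> Prop) :
  (forall g, D g <-> D' g) -> dfn B D -> dfn B D'.
Proof.
by move=> DD' [k kB kD]; exists k => // g; split=> [/DD'/kD|/kD/DD'].
Qed.

Lemma dfn_subst V W (B : set C) (D : (V -> C) -> Prop) (s : V -> W + C) :
  (forall v c, s v = inr c -> B c) -> dfn B D ->
  dfn B (fun g : W -> C => D (fsum g id \o s)).
Proof.
move=> sB [[n phi x] kB kD].
exists (Code phi (fun i => match x i with inl v => s v | inr c => inr c end)).
  move=> c [i /=]; case e: (x i) => [v|c'].
    exact: sB.
  by case=> <-; apply: kB; exists i.
move=> g; rewrite kD /csat /=.
suff -> : fsum (fsum g id \o s) id \o x =
  fsum g id \o (fun i => match x i with inl v => s v | inr c => inr c end) by [].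
by apply: funext => i /=; case: (x i).
Qed.

Lemma dfn_var V W (B : set C) (D : (V -> C) -> Prop) (s : V -> W) :
  dfn B D -> dfn B (fun g : W -> C => D (g \o s)).
Proof. exact: (@dfn_subst _ _ _ _ (inl \o s)). Qed.

Lemma dfn_fsat V (B : set C) n (phi : formula L n) (s : 'I_n -> V) :
  dfn B (fun g => fsat phi (g \o s)).
Proof. by exists (Code phi (inl \o s)) => // c []. Qed.

Lemma dfn_false V (B : set C) : @dfn V B (fun _ => False).
Proof.
by exists (@Code V 0 (Bot L 0) (fun i => match i with Ordinal _ h => False_rect _ (notF h) end))
  => [c [[]]|g].
Qed.

Lemma dfn_imp V (B : set C) (D D' : (V -> C) -> Prop) :
  dfn B D -> dfn B D' -> dfn B (fun g => D g -> D' g).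
Proof.
move=> [[n phi x] kB kD] [[n' phi' x'] kB' kD'].
exists (Code (Imp (rename phi (lshift n')) (rename phi' (@rshift n n'))) (fcat x x')).
  move=> c [i]; rewrite /= /fcat; case: fintype.split => j e.
    by apply: kB; exists j.
  by apply: kB'; exists j.
move=> g; rewrite kD kD' /csat /fsat /=.
have := fsat_rename phi (lshift n') (fsum g id \o fcat x x').
have := fsat_rename phi' (@rshift n n') (fsum g id \o fcat x x').
have -> : (fsum g id \o fcat x x') \o lshift n' = fsum g id \o x.
  by apply: funext => i /=; rewrite fcat_lshift.
have -> : (fsum g id \o fcat x x') \o @rshift n n' = fsum g id \o x'.
  by apply: funext => i /=; rewrite fcat_rshift.
by rewrite /fsat; tauto.
Qed.

Lemma dfn_not V (B : set C) (D : (V -> C) -> Prop) :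
  dfn B D -> dfn B (fun g => ~ D g).
Proof. by move=> dD; apply: dfn_imp dD _; exact: dfn_false. Qed.

Lemma dfn_true V (B : set C) : @dfn V B (fun _ => True).
Proof. by apply: dfn_ext (dfn_not (dfn_false V B)) => g; tauto. Qed.

Lemma dfn_const V (B : set C) (Q : Prop) : @dfn V B (fun _ => Q).
Proof.
have [q|q] := pselect Q.
  by apply: dfn_ext (dfn_true V B) => g; tauto.
by apply: dfn_ext (dfn_false V B) => g; tauto.
Qed.

Lemma dfn_and V (B : set C) (D D' : (V -> C) -> Prop) :
  dfn B D -> dfn B D' -> dfn B (fun g => D g /\ D' g).
Proof.
move=> dD dD'; apply: dfn_ext (dfn_not (dfn_imp dD (dfn_not dD'))) => g.
by split=> [h|[] //]; apply: contrapT; tauto.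
Qed.

Lemma dfn_iff V (B : set C) (D D' : (V -> C) -> Prop) :
  dfn B D -> dfn B D' -> dfn B (fun g => D g <-> D' g).
Proof. by move=> dD dD'; apply: dfn_and; apply: dfn_imp. Qed.

(* The bound variable is the new element [None] of [option V]. *)
Lemma dfn_all V (B : set C) (D : C -> (V -> C) -> Prop) :
  dfn B (fun g : option V -> C => D (g None) (g \o some)) ->
  dfn B (fun g => forall c, D c g).
Proof.
move=> [[n phi x] kB kD].
pose gc c (g : V -> C) (o : option V) := oapp g c o.
have DE c g : D c g <-> fsat phi (fsum (gc c g) id \o x).
  by have := kD (gc c g); rewrite /csat.
(* The indices of the bound variable survive in the renamed formula without occurring in it, and
   still need some value; that of another index [i0] serves. If there is no other index, [V] and [B]
   may both be empty, and the new formula is a sentence. *)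
have [[i0 i0N]|allN] := pselect (exists i, x i <> inl None).
  pose r (i : 'I_n) : 'I_n.+1 := if x i is inl None then ord0 else lift ord0 i.
  pose drop (y : option V + C) (z : V + C) : V + C :=
    match y with inl None => z | inl (Some v) => inl v | inr c => inr c end.
  have [z zB] : exists z : V + C, forall c, z = inr c -> B c.
    case e: (x i0) i0N => [[v|]|c] // _; first by exists (inl v).
    by exists (inr c) => c' [<-]; apply: kB; exists i0.
  exists (Code (All (rename phi r)) (fun i => drop (x i) z)).
    move=> c [i /=]; case e: (x i) => [[v|]|c'] //= ec; first exact: zB.
    by case: ec => <-; apply: kB; exists i.
  have eqv c g : fcons c (fsum g id \o (fun i => drop (x i) z)) \o r =
      fsum (gc c g) id \o x.
    apply: funext => i /=; rewrite /r; case e: (x i) => [[v|]|c'];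
    by rewrite ?fcons0 ?fconsS //= e.
  by move=> g; rewrite /csat fsat_all; split=> h c; have := h c;
    rewrite DE fsat_rename eqv.
have xN i : x i = inl None by apply: contrapT => ne; apply: allN; exists i.
pose y0 (i : 'I_0) : V + C := match i with Ordinal _ h => False_rect _ (notF h) end.
exists (Code (All (rename phi (fun=> ord0))) y0); first by move=> c [[]].
have eqv c g : fcons c (fsum g id \o y0) \o (fun=> ord0) = fsum (gc c g) id \o x.
  by apply: funext => i /=; rewrite fcons0 xN.
by move=> g; rewrite /csat fsat_all; split=> h c; have := h c;
  rewrite DE fsat_rename eqv.
Qed.

Lemma dfn_ex V (B : set C) (D : C -> (V -> C) -> Prop) :
  dfn B (fun g : option V -> C => D (g None) (g \o some)) ->
  dfn B (fun g => exists c, D c g).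
Proof.
move=> /dfn_not dD; have := dfn_not (dfn_all (D := fun c g => ~ D c g) dD).
apply: dfn_ext => g; split=> [h|[c Dc] /(_ c)//].
by apply: contrapT => nD; apply: h => c Dc; apply: nD; exists c.
Qed.

Lemma dfn_exv V k (B : set C) (D : ('I_k -> C) -> (V -> C) -> Prop) :
  dfn B (fun g : 'I_k + V -> C => D (g \o inl) (g \o inr)) ->
  dfn B (fun g => exists h, D h g).
Proof.
elim: k V D => [|k IH] V D dD.
  have e (h : 'I_0 -> C) (h' : 'I_0 -> C) : h = h' by apply: funext => -[].
  pose s (x : 'I_0 + V) : V := match x with inl (Ordinal _ h) => False_rect _ (notF h) | inr v => v end.
  apply: dfn_ext (dfn_var s dD) => g; split=> [h|[h Dh]]; first by exists ((g \o s) \o inl).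
  by rewrite (e ((g \o s) \o inl) h).
have -> : (fun g => exists h, D h g) = (fun g => exists c, exists h, D (fcons c h) g).
  apply: funext => g; apply: propext; split=> [[h Dh]|[c [h Dh]]]; last by exists (fcons c h).
  by exists (h ord0), (h \o lift ord0); rewrite fcons_eta.
apply: dfn_ex; apply: (IH _ (fun h g => D (fcons (g None) h) (g \o some))).
pose s (x : 'I_k.+1 + V) : 'I_k + option V :=
  match x with
  | inl i => if unlift ord0 i is Some j then inl j else inr None
  | inr v => inr (Some v) end.
apply: dfn_ext (dfn_var s dD) => g.
suff -> : (g \o s) \o inl = fcons ((g \o inr) None) (g \o inl) by [].
by apply: funext => i /=; rewrite /s /fcons; case: unliftP.
Qed.

Lemma dfn_allv V k (B : set C) (D : ('I_k -> C) -> (V -> C) -> Prop) :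
  dfn B (fun g : 'I_k + V -> C => D (g \o inl) (g \o inr)) ->
  dfn B (fun g => forall h, D h g).
Proof.
move=> /dfn_not dD; have := dfn_not (dfn_exv (D := fun c g => ~ D c g) dD).
apply: dfn_ext => g; split=> [h c|h [c]]; last by apply.
by apply: contrapT => nD; apply: h; exists c.
Qed.

Lemma split_family V n (x : 'I_n -> V + C) : exists k (u : 'I_k -> V) r (w : 'I_r -> C)
    (s : 'I_n -> 'I_k + 'I_r),
  (forall j, exists i, x i = inr (w j)) /\
  forall i, x i = match s i with inl a => inl (u a) | inr b => inr (w b) end.
Proof.
have noord (U : Type) (i : 'I_0) : U by case: i.
elim: n x => [|n IH] x.
  exists 0, (noord V), 0, (noord C), (noord _); by split=> -[].
have [k [u [r [w [s [wP sP]]]]]] := IH (x \o lift ord0).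
case e: (x ord0) => [v|c].
  exists k.+1, (fcons v u), r, w, (fcons (inl ord0)
    (fun i => match s i with inl a => inl (lift ord0 a) | inr b => inr b end)); split.
    by move=> j; have [i] := wP j; exists (lift ord0 i).
  move=> i; case: (unliftP ord0 i) => [j|] ->; rewrite ?fconsS ?fcons0 ?e //.
  by rewrite -[x _]/((x \o lift ord0) j) sP; case: (s j) => // a; rewrite fconsS.
exists k, u, r.+1, (fcons c w), (fcons (inr ord0)
  (fun i => match s i with inl a => inl a | inr b => inr (lift ord0 b) end)); split.
  move=> j; case: (unliftP ord0 j) => [j'|] ->; last by exists ord0; rewrite fcons0.
  by have [i] := wP j'; exists (lift ord0 i); rewrite fconsS.
move=> i; case: (unliftP ord0 i) => [j|] ->; rewrite ?fconsS ?fcons0 ?e //.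
by rewrite -[x _]/((x \o lift ord0) j) sP; case: (s j) => // a; rewrite fconsS.
Qed.

Lemma dfn_nf V (B : set C) (D : (V -> C) -> Prop) : dfn B D ->
  exists k (u : 'I_k -> V) r (w : 'I_r -> C) (phi : formula L (k + r)),
    range w `<=` B /\ forall g, D g <-> fsat phi (fcat (g \o u) w).
Proof.
move=> [[n phi x] kB kD]; have [k [u [r [w [s [wP sP]]]]]] := split_family x.
exists k, u, r, w, (rename phi (fun i => unsplit (s i))); split.
  by move=> _ [j _ <-]; apply: kB; have [i] := wP j; exists i.
move=> g; rewrite kD fsat_rename /csat /=.
suff -> : fsum g id \o x = fcat (g \o u) w \o (fun i => unsplit (s i)) by [].
by apply: funext => i /=; rewrite sP /fcat unsplitK; case: (s i).
Qed.
End Definability.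

Arguments code_body {L C V} c.
Arguments code_var {L C V} c i.

(** * Parameters, types and elementary submodels in terms of definable predicates *)

Section Sets.
Variables (L : language) (P : rel_sym L) (C : structure L).
Local Notation PC := (Pset P C).
Local Notation dfn := (@dfn L C _).

Lemma dfn_P V (B : set C) (v : V) : dfn B (fun g => PC (g v)).
Proof.
have := @dfn_fsat L C V B 1 (Rel (nseq_tuple (arity P) ord0)) (fun=> v).
apply: dfn_ext => g; rewrite /fsat /= /Pset /=; set t := map_tuple _ _.
suff -> : t = nseq_tuple (arity P) (g v) by [].
by apply: eq_from_tnth => i; rewrite !(tnth_map, tnth_mktuple, tnth_nseq).
Qed.

Lemma dfn_forall V k (B : set C) (D : 'I_k -> (V -> C) -> Prop) :
  (forall i, dfn B (D i)) -> dfn B (fun g => forall i, D i g).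
Proof.
elim: k D => [|k IH] D dD.
  by apply: dfn_ext (dfn_true _ B) => g; split=> // _ [].
apply: dfn_ext (dfn_and (dD ord0) (IH (fun i => D (lift ord0 i)) (fun i => dD _))) => g.
split=> [[D0 DS] i|Dg]; last by split.
by case: (unliftP ord0 i) => [j|] ->.
Qed.

Lemma dfn_allP V k (B : set C) (s : 'I_k -> V) :
  dfn B (fun g => forall i, PC (g (s i))).
Proof. by apply: dfn_forall => i; exact: dfn_P. Qed.

Lemma dfn_pformula n (B : set C) (D : ('I_n -> C) -> Prop) : dfn B D ->
  exists2 f : pformula C n, tuple_in (pf_params f) B &
    forall x : n.-tuple C, D (tnth x) <-> psat f x.
Proof.
move=> /dfn_nf[k [u [r [w [phi [wB Dphi]]]]]].
pose s (i : 'I_(k + r)) : 'I_(n + r) :=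
  match fintype.split i with inl a => lshift r (u a) | inr b => rshift n b end.
exists (PFormula (rename phi s) [tuple w i | i < r]).
  by rewrite /tuple_in /= tnth_mktupleE.
move=> x; rewrite Dphi /psat /= sat_fsat tnth_cat tnth_mktupleE fsat_rename.
suff -> : fcat (tnth x \o u) w = fcat (tnth x) w \o s by [].
apply: funext => i; rewrite /= /s {1}/fcat; case: fintype.split => j.
  by rewrite fcat_lshift.
by rewrite fcat_rshift.
Qed.

Lemma pformula_dfn n (B : set C) (f : pformula C n) : tuple_in (pf_params f) B ->
  dfn B (fun x => psat f [tuple x i | i < n]).
Proof.
move=> fB; exists (Code (pf_body f) (fun i => match fintype.split i with
    inl a => inl a | inr b => inr (tnth (pf_params f) b) end)).
  by move=> c [i /=]; case: fintype.split => // j [<-]; apply: fB; exists j.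
move=> g; rewrite /csat /psat sat_fsat tnth_cat tnth_mktupleE /=.
suff -> : fcat g (tnth (pf_params f)) = fsum g id \o (fun i => match fintype.split i with
    inl a => inl a | inr b => inr (tnth (pf_params f) b) end) by [].
by apply: funext => i /=; rewrite /fcat; case: fintype.split.
Qed.

Lemma dfn_fin V (B : set C) (D : (V -> C) -> Prop) : dfn B D ->
  exists k (u : 'I_k -> V) (E : ('I_k -> C) -> Prop),
    dfn B E /\ forall g, D g <-> E (g \o u).
Proof.
move=> /dfn_nf[k [u [r [w [phi [wB Dphi]]]]]].
exists k, u, (fun h => fsat phi (fcat h w)); split => //.
exists (Code phi (fun i => match fintype.split i with
    inl a => inl a | inr b => inr (w b) end)).
  by move=> c [i /=]; case: fintype.split => // j [<-]; apply: wB; exists j.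
move=> g; rewrite /csat /=.
suff -> : fcat g w = fsum g id \o (fun i => match fintype.split i with
    inl a => inl a | inr b => inr (w b) end) by [].
by apply: funext => i /=; rewrite /fcat; case: fintype.split.
Qed.

(** Turning the parameters [c] into variables lets a formula over [B] and [c] be evaluated at other
    tuples; [dfn_glue] is the converse. *)
Lemma dfn_sep V W (B : set C) (c : W -> C) (D : (V -> C) -> Prop) :
  dfn (B `|` range c) D ->
  exists2 E : (W + V -> C) -> Prop, dfn B E & forall g, D g <-> E (fsum c g).
Proof.
move=> [[n phi x] kB kD].
have sP i : exists y : (W + V) + C, (forall d, y = inr d -> B d) /\
    forall g : V -> C, fsum g id (x i) = fsum (fsum c g) id y.
  case e: (x i) => [v|d]; first by exists (inl (inr v)).
  have [Bd|[j _ <-]] : (B `|` range c) d by apply: kB; exists i.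
    by exists (inr d); split=> // d' [<-].
  by exists (inl (inl j)).
have [s sP'] := choice sP.
exists (csat (Code phi s)).
  by exists (Code phi s) => // d [i /= e]; exact: (proj1 (sP' i)).
move=> g; rewrite kD /csat /=.
suff -> : fsum g id \o x = fsum (fsum c g) id \o s by [].
by apply: funext => i; exact: (proj2 (sP' i)).
Qed.

Lemma dfn_glue V W (B B' : set C) (c : W -> C) (E : (W + V -> C) -> Prop) :
  dfn B E -> B `<=` B' -> range c `<=` B' -> dfn B' (fun g => E (fsum c g)).
Proof.
move=> dE BB' cB'.
pose s (x : W + V) : V + C := match x with inl w => inr (c w) | inr v => inl v end.
have : dfn B' (fun g : V -> C => E (fsum g id \o s)).
  apply: dfn_subst; last exact: dfn_sub dE.
  by move=> [w|v] //= d [<-]; apply: cB'; exists w.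
by apply: dfn_ext => g; rewrite (_ : fsum g id \o s = fsum c g) //;
  apply: funext => -[].
Qed.

(* The Tarski-Vaught criterion, for tuples. *)
Definition TV (N : set C) := forall k (D : ('I_k -> C) -> Prop), dfn N D ->
  (exists h, D h) -> exists2 h, range h `<=` N & D h.

Lemma dfn_fcons V k (B : set C) (D : ('I_k.+1 -> C) -> Prop) (v : V) : dfn B D ->
  dfn B (fun g => exists h, D (fcons (g v) h)).
Proof.
move=> dD.
pose s (i : 'I_k.+1) : 'I_k + V := oapp inl (inr v) (unlift ord0 i).
apply: (dfn_exv (D := fun h g => D (fcons (g v) h))).
apply: dfn_ext (dfn_var s dD) => g.
suff -> : g \o s = fcons ((g \o inr) v) (g \o inl) by [].
by apply: funext => i /=; rewrite /s /fcons; case: unlift.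
Qed.

Lemma dfn_fcons_param k (B : set C) (D : ('I_k.+1 -> C) -> Prop) c : B c -> dfn B D ->
  dfn B (fun h => D (fcons c h)).
Proof.
move=> Bc dD.
pose s (i : 'I_k.+1) : 'I_k + C := oapp inl (inr c) (unlift ord0 i).
have sB i d : s i = inr d -> B d by rewrite /s; case: unliftP => //= _ [<-].
apply: dfn_ext (dfn_subst sB dD) => g.
suff -> : fsum g id \o s = fcons c g by [].
by apply: funext => i /=; rewrite /s /fcons; case: unlift.
Qed.

Lemma range_fcons k (B : set C) c (h : 'I_k -> C) :
  B c -> range h `<=` B -> range (fcons c h) `<=` B.
Proof.
move=> Bc hB _ [i _ <-]; rewrite /fcons; case: unliftP => [j|] _ //=.
by apply: hB; exists j.
Qed.

Lemma TV_one (N : set C) :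
  (forall D : C -> Prop, dfn N (fun g : unit -> C => D (g tt)) ->
     (exists c, D c) -> exists2 c, N c & D c) -> TV N.
Proof.
move=> tv1; elim=> [|k IH] D dD [h Dh].
  by exists h => // c [[]].
have [c Nc [h' Dh']] : exists2 c, N c & exists h, D (fcons c h).
  apply: (tv1 (fun c => exists h, D (fcons c h)) (dfn_fcons _ dD)).
  by exists (h ord0), (h \o lift ord0); rewrite fcons_eta.
have [|h'' h''N Dh''] := IH _ (dfn_fcons_param Nc dD); first by exists h'.
by exists (fcons c h'') => //; exact: range_fcons.
Qed.

Lemma dfn_one (B : set C) (D : C -> Prop) :
  dfn B (fun g : unit -> C => D (g tt)) ->
  exists r (w : 'I_r -> C) (psi : formula L r.+1), range w `<=` B /\
    forall c, D c <-> fsat psi (fcons c w).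
Proof.
move=> /dfn_nf[k [u [r [w [phi [wN Dphi]]]]]].
pose s (i : 'I_(k + r)) : 'I_r.+1 :=
  match fintype.split i with inl _ => ord0 | inr j => lift ord0 j end.
exists r, w, (rename phi s); split=> // c.
rewrite (Dphi (fun=> c)) fsat_rename.
suff -> : fcat ((fun=> c) \o u) w = fcons c w \o s by [].
apply: funext => i /=; rewrite /s /fcat; case: fintype.split => j.
  by rewrite fcons0.
by rewrite fconsS.
Qed.

Lemma TV_elementary (N : set C) : elementary_submodel N -> TV N.
Proof.
move=> el; apply: TV_one => D /dfn_one[r [w [psi [wN Dpsi]]]] [c Dc].
have wN' i : w i \in N by apply: mem_set; apply: wN; exists i.
pose v : r.-tuple (induced N) := [tuple SigSub (wN' i) | i < r].
have vw : tnth (map_tuple val v : r.-tuple C) = w.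
  by apply: funext => i; rewrite tnth_map tnth_mktuple.
apply: contrapT => nc; have [elv _] := el _ (All (Imp psi (Bot L _))) v.
have : sat psi (cons_tuple c (map_tuple val v : r.-tuple C)).
  by rewrite sat_fsat tnth_cons vw -Dpsi.
apply: (elv _ c) => x /= /el; rewrite sat_fsat => sx; apply: nc; exists (val x).
  exact/set_mem/valP.
rewrite Dpsi -vw -tnth_cons -sat_fsat.
move: sx; rewrite -sat_fsat; congr (sat psi _); exact: val_inj.
Qed.

Lemma elementary_TV (N : set C) : TV N -> elementary_submodel N.
Proof.
move=> tv n phi; elim: phi => {n} [n|n i j|n R x|n phi IH1 psi IH2|n phi IH] v.
- by [].
- rewrite /= !tnth_map; split=> [-> //|]; exact: val_inj.
- rewrite /=; set t := map_tuple _ _; set t' := map_tuple _ _.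
  suff -> : t = t' by [].
  by apply: eq_from_tnth => i; rewrite !tnth_map.
- by rewrite /= IH1 IH2.
have consE x : map_tuple val (cons_tuple x v) = cons_tuple (val x) (map_tuple val v) :> n.+1.-tuple C.
  exact: val_inj.
split=> /= h x; last by rewrite IH consE.
apply: contrapT => nx.
pose w := tnth (map_tuple val v : n.-tuple C).
have wN : range w `<=` N.
  by move=> _ [i _ <-]; rewrite /w tnth_map; exact/set_mem/valP.
have dD : dfn N (fun y : 'I_1 -> C => ~ fsat phi (fcons (y ord0) w)).
  apply: dfn_not; apply: (@dfn_glue _ 'I_n N _ w (fun g => fsat phi (fcons (g (inr ord0)) (g \o inl)))) => //.
  pose s (i : 'I_n.+1) : 'I_n + 'I_1 := oapp inl (inr ord0) (unlift ord0 i).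
  apply: dfn_ext (@dfn_fsat L C _ N _ phi s) => g.
  suff -> : g \o s = fcons (g (inr ord0)) (g \o inl) by [].
  by apply: funext => i /=; rewrite /s /fcons; case: unlift.
have [|y yN] := tv _ _ dD.
  by exists (fun=> x); rewrite /w -tnth_cons -sat_fsat.
apply; have y0 : y ord0 \in N by apply: mem_set; apply: yN; exists ord0.
rewrite /w -tnth_cons -sat_fsat.
by have := h (SigSub y0); rewrite IH consE.
Qed.
End Sets.

(** * Complete sets and traces on [P] *)

Lemma inaccessible_strongly (L : language) (K : Type) :
  inaccessible_above L K -> strongly_inaccessible K.
Proof.
move=> [sF hpow hcup]; split=> //; exists {n & formula L n}; split; last exact: small_sm.
by exists (fun n => existT (formula L) n (Bot L n)) => n m [].
Qed.

Section Completeness.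
Variables (L : language) (P : rel_sym L) (K : Type) (C : structure L).
Local Notation PC := (Pset P C).
Local Notation dfn := (@dfn L C _).

Section Saturation.
Hypothesis Csat : saturated K C.

Lemma saturation n (B : set C) (G : set (('I_n -> C) -> Prop)) : sm K B ->
  (forall D, G D -> dfn B D) ->
  (forall l, all_of G l -> exists x, all_of (fun D => D x) l) ->
  exists x, forall D, G D -> D x.
Proof.
move=> sB dG fsG.
pose p := [set f : pformula C n | tuple_in (pf_params f) B /\
  exists2 D, G D & forall x : n.-tuple C, D (tnth x) <-> psat f x].
have [q /(@finite_seqP {classic pformula C n})[s ->] qp|x xp] := Csat (sm_small sB) (p := p)
  (fun f => @proj1 _ _).
- suff [l lG lP] : exists2 l, all_of G l & forall x : n.-tuple C,
      all_of (fun D => D (tnth x)) l -> forall f, f \in s -> psat f x.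
    have [x xl] := fsG l lG; exists [tuple x i | i < n] => f fs.
    by apply: (lP) fs; rewrite tnth_mktupleE.
  elim: s qp => [|f s IH] qp; first by exists [::] => // x _ f.
  have [|l lG lP] := IH; first by move=> f' fs; apply: qp; rewrite /= inE fs orbT.
  have [_ [D GD Df]] : p f by apply: qp; rewrite /= inE eqxx.
  exists (D :: l) => //= x [Dx lx] f'; rewrite inE => /orP[/eqP->|f's]; last exact: lP.
  exact/Df.
- exists (tnth x) => D GD; have [f fB Df] := dfn_pformula (dG _ GD).
  by apply/Df; apply: xp; split=> //; exists D.
Qed.
End Saturation.

(* [comp N A], for [N `<=` A]: the set [A] is complete and [P] meets [A] in
   [P^C `&` N]. *)
Definition comp (N A : set C) := forall D : C -> Prop,
  dfn A (fun g : unit -> C => D (g tt)) ->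
  (exists2 z, PC z & D z) -> exists2 z, PC z /\ N z & D z.

Lemma comp_sub N A A' : A `<=` A' -> comp N A' -> comp N A.
Proof. by move=> AA' cA D dD; apply: cA; exact: dfn_sub dD. Qed.

Lemma compv N A k (D : ('I_k -> C) -> Prop) : N `<=` A -> comp N A -> dfn A D ->
  (exists2 h, range h `<=` PC & D h) -> exists2 h, range h `<=` PC `&` N & D h.
Proof.
move=> NA cA; elim: k D => [|k IH] D dD [h hP Dh]; first by exists h => // c [[]].
have [c [Pc Nc] [h' [h'P Dh']]] : exists2 c, PC c /\ N c &
    exists h, (forall i, PC (h i)) /\ D (fcons c h).
  apply: (cA (fun c => exists h, (forall i, PC (h i)) /\ D (fcons c h))).
    pose s (i : 'I_k.+1) : 'I_k + unit := oapp inl (inr tt) (unlift ord0 i).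
    apply: (dfn_exv (D := fun h g => (forall i, PC (h i)) /\ D (fcons (g tt) h))).
    apply: dfn_and; first exact: dfn_allP.
    apply: dfn_ext (dfn_var s dD) => g.
    suff -> : g \o s = fcons ((g \o inr) tt) (g \o inl) by [].
    by apply: funext => i /=; rewrite /s /fcons; case: unlift.
  exists (h ord0); first by apply: hP; exists ord0.
  exists (h \o lift ord0); rewrite fcons_eta; split=> // i.
  by apply: hP; exists (lift ord0 i).
have [|h'' h''N Dh''] := IH _ (dfn_fcons_param (NA _ Nc) dD).
  by exists h' => // _ [i _ <-].
by exists (fcons c h'') => //; exact: range_fcons.
Qed.

Section Trace.
Hypothesis H2 : hypothesis_H2 P C.

(** H2 is applied to the type over [P] of the parameters [w] of [D]. The renaming [sw] exchanges
    variables and parameters, so that the definition of this type is the trace of [D]. *)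
Lemma traceP V (B : set C) (D : (V -> C) -> Prop) : dfn B D ->
  exists2 D' : (V -> C) -> Prop, dfn PC D' &
    forall g, range g `<=` PC -> (D g <-> D' g).
Proof.
move=> /dfn_nf[k [u [r [w [phi [wB Dphi]]]]]].
pose wt := [tuple w i | i < r].
pose sw (i : 'I_(k + r)) : 'I_(r + k) :=
  match fintype.split i with inl a => rshift r a | inr b => lshift k b end.
have [Psi PsiP Psidef] := H2 (ex_intro (fun c => tp wt PC = tp c PC) wt erefl) (rename phi sw).
exists (fun g => psat Psi [tuple (g \o u) i | i < k]).
  exact: (dfn_var u (pformula_dfn PsiP)).
move=> g gP; rewrite Dphi.
have bP : tuple_in [tuple (g \o u) i | i < k] PC.
  by move=> _ [i _ <-]; rewrite tnth_mktuple; apply: gP; exists (u i).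
rewrite -(Psidef _ bP) /tp /= /psat /= sat_fsat tnth_cat !tnth_mktupleE fsat_rename.
suff -> : fcat w (g \o u) \o sw = fcat (g \o u) w by split=> [|[]].
apply: funext => i; rewrite /= /sw {2}/fcat; case: fintype.split => j.
  by rewrite fcat_rshift.
by rewrite fcat_lshift.
Qed.

Definition traced (N B : set C) := forall V (D : (V -> C) -> Prop), dfn B D ->
  exists2 D' : (V -> C) -> Prop, dfn N D' &
    forall g, range g `<=` PC -> (D g <-> D' g).

Lemma traced_fin (N B : set C) :
  (forall k (D : ('I_k -> C) -> Prop), dfn B D ->
   exists2 D' : ('I_k -> C) -> Prop, dfn N D' &
     forall g, range g `<=` PC -> (D g <-> D' g)) -> traced N B.
Proof.
move=> tr V D /dfn_fin[k [u [E [dE DE]]]]; have [E' dE' EE'] := tr _ _ dE.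
exists (fun g => E' (g \o u)); first exact: dfn_var.
by move=> g gP; rewrite DE; apply: EE' => _ [i _ <-]; apply: gP; exists (u i).
Qed.

(** Isolating the parameters [d] in [P] makes being a defining parameter of the trace a first-order
    property of [d] ([dfn_agreeP]), to which completeness of a set can be applied. *)
Lemma trace_formula (B : set C) k (D : ('I_k -> C) -> Prop) : dfn B D ->
  exists r (E : ('I_r + 'I_k -> C) -> Prop), dfn set0 E /\
    exists2 d : 'I_r -> C, range d `<=` PC &
      forall h, range h `<=` PC -> (D h <-> E (fsum d h)).
Proof.
move=> dD; have [D' dD' DD'] := traceP dD.
have [n [u [r [w [phi [wP D'phi]]]]]] := dfn_nf dD'.
pose s (i : 'I_(n + r)) : 'I_r + 'I_k :=
  match fintype.split i with inl a => inr (u a) | inr b => inl b end.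
exists r, (fun g => fsat phi (g \o s)); split; first exact: dfn_fsat.
exists w => // h hP; rewrite DD' // D'phi.
suff -> : fcat (h \o u) w = fsum w h \o s by [].
by apply: funext => i /=; rewrite /s /fcat; case: fintype.split.
Qed.

Lemma dfn_agreeP (B : set C) r k (D : ('I_k -> C) -> Prop)
    (E : ('I_r + 'I_k -> C) -> Prop) : dfn B D -> dfn B E ->
  dfn B (fun d => forall h, (forall i, PC (h i)) -> (D h <-> E (fsum d h))).
Proof.
move=> dD dE.
apply: (dfn_allv (D := fun h d => (forall i, PC (h i)) -> (D h <-> E (fsum d h)))).
apply: dfn_imp; first exact: dfn_allP.
apply: dfn_iff; first exact: dfn_var.
pose s (x : 'I_r + 'I_k) : 'I_k + 'I_r := match x with inl i => inr i | inr i => inl i end.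
apply: dfn_ext (dfn_var s dE) => g.
by rewrite (_ : g \o s = fsum (g \o inr) (g \o inl)) //; apply: funext => -[].
Qed.

End Trace.

Lemma tp_dfn n (c c' : n.-tuple C) (N : set C) (D : ('I_n -> C) -> Prop) :
  tp c N = tp c' N -> dfn N D -> D (tnth c) -> D (tnth c').
Proof.
move=> e /dfn_pformula[f fN Df] /Df sf; apply/Df.
by have [] : tp c' N f by rewrite -e.
Qed.

(** [S_star] speaks of some realization of the type; completeness passes to all others, since
    solvability in [P] of an instance and each particular solution in [N] are part of the type over
    [N]. *)
Lemma comp_tp n (c c' : n.-tuple C) (N : set C) : tp c N = tp c' N ->
  comp N (N `|` range (tnth c)) -> comp N (N `|` range (tnth c')).
Proof.
move=> e cN D /dfn_sep[E dE DE] [z Pz Dz].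
pose X (y : 'I_n -> C) := exists z, PC z /\ E (fsum y (fun _ : unit => z)).
have dX : dfn N X.
  apply: (dfn_ex (D := fun z y => PC z /\ E (fsum y (fun=> z)))).
  apply: dfn_and; first exact: dfn_P.
  pose s (x : 'I_n + unit) : option 'I_n := if x is inl i then Some i else None.
  apply: dfn_ext (dfn_var s dE) => g.
  by rewrite (_ : g \o s = fsum (g \o some) (fun=> g None)) //; apply: funext => -[].
have DE' z' : D z' <-> E (fsum (tnth c') (fun _ : unit => z')) by rewrite -DE.
have [z' [Pz' Ez']] : X (tnth c).
  by apply: (tp_dfn (esym e) dX); exists z; split=> //; rewrite -DE'.
have [||z0 [Pz0 Nz0] Ez0] := cN (fun z => E (fsum (tnth c) (fun _ : unit => z))).
- have := @dfn_glue L C unit _ N (N `|` range (tnth c)) (tnth c) E dE.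
  move=> /(_ (@subsetUl _ _ _) (@subsetUr _ _ _)); apply: dfn_ext => g.
  by rewrite (_ : (fun=> g tt) = g) //; apply: funext => -[].
- by exists z'.
exists z0 => //; rewrite DE'.
apply: (tp_dfn (D := fun y => E (fsum y (fun=> z0))) e) Ez0.
pose s (x : 'I_n + unit) : 'I_n + C := if x is inl i then inl i else inr z0.
have sN x d : s x = inr d -> N d by case: x => //= _ [<-].
apply: dfn_ext (dfn_subst sN dE) => g.
by rewrite (_ : fsum g id \o s = fsum g (fun=> z0)) //; apply: funext => -[].
Qed.

Lemma S_star_comp n (c : n.-tuple C) (N : set C) :
  S_star P N (tp c N) -> comp N (N `|` range (tnth c)).
Proof.
move=> [c' [e PN cs]]; apply: (comp_tp (esym e)) => D /dfn_one[r [w [psi [wN Dpsi]]]] [z Pz Dz].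
pose s (i : 'I_r.+1) : 'I_(1 + r) := i.
have wt : tuple_in [tuple w i | i < r] (N `|` range (tnth c')).
  by move=> _ [i _ <-]; rewrite tnth_mktuple; apply: wN; exists i.
have E y : fcat (tnth [tuple y | _ < 1]) (tnth [tuple w i | i < r]) = fcons y w.
  rewrite !tnth_mktupleE; apply: funext => i; rewrite /fcat /fcons.
  case: fintype.splitP => j ij; case: unliftP => [j'|] ej //=.
  - by move: ij; rewrite ej (ord1 j).
  - congr w; apply: val_inj; move: ij; rewrite ej /= /bump /= => -[].
    by [].
  - by move: ij; rewrite ej.
have [|a aP] := cs 1 r psi _ wt.
  exists [tuple z | _ < 1]; first by move=> _ [i _ <-]; rewrite tnth_mktuple.
  by rewrite sat_fsat tnth_cat E -Dpsi.
have -> : a = [tuple tnth a ord0 | _ < 1].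
  by apply: eq_from_tnth => i; rewrite tnth_mktuple (ord1 i).
rewrite sat_fsat tnth_cat E -Dpsi => Da; exists (tnth a ord0) => //.
have : (PC `&` (N `|` range (tnth c'))) (tnth a ord0) by apply: aP; exists ord0.
by rewrite PN.
Qed.

Lemma comp_S_star n (c : n.-tuple C) (N : set C) :
  comp N (N `|` range (tnth c)) -> S_star P N (tp c N).
Proof.
move=> cN; exists c; split=> //.
  apply/seteqP; split=> z [Pz Nz]; split=> //; last by left.
  (* The formula with parameter [z] stating equality with [z] has no other solution, so completeness
     puts [z] itself into [N]. *)
  have [|z0 [Pz0 Nz0] /= ->//] := cN (fun y => z = y) _ (ex_intro2 _ _ z Pz erefl).
  exists (Code (Eq L ord0 ord_max) (fun i : 'I_2 => if i == ord0 then inr z else inl tt)).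
    by move=> d [i /=]; case: eqP => // _ [<-].
  by move=> g; rewrite /csat /= fsat_eq.
move=> m k psi b bN [a aP sa].
have [||h hN sh] := compv (@subsetUl _ _ _) cN (D := fun h => fsat psi (fcat h (tnth b))).
- exists (Code psi (fun i => match fintype.split i with inl j => inl j | inr j => inr (tnth b j) end)).
    by move=> d [i /=]; case: fintype.split => // j [<-]; apply: bN; exists j.
  move=> g; rewrite /csat /=.
  suff -> : fcat g (tnth b) = fsum g id \o
    (fun i => match fintype.split i with inl j => inl j | inr j => inr (tnth b j) end) by [].
  by apply: funext => i /=; rewrite /fcat; case: fintype.split.
- by exists (tnth a) => //; rewrite -tnth_cat -sat_fsat.
exists [tuple h i | i < m]; last by rewrite sat_fsat tnth_cat tnth_mktupleE.
move=> z; rewrite tnth_mktupleE => /hN[Pz Nz]; split=> //; by left.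
Qed.
End Completeness.

(** * The rank *)

Section Rank.
Variables (L : language) (P : rel_sym L) (K : Type) (C : structure L).
Local Notation PC := (Pset P C).
Local Notation dfn := (@dfn L C _).

Lemma dfn_params V (B : set C) (D : (V -> C) -> Prop) : dfn B D ->
  exists r (E : ('I_r + V -> C) -> Prop), dfn set0 E /\
    exists2 w : 'I_r -> C, range w `<=` B & forall g, D g <-> E (fsum w g).
Proof.
move=> /dfn_nf[k [u [r [w [phi [wB Dphi]]]]]].
pose s (i : 'I_(k + r)) : 'I_r + V :=
  match fintype.split i with inl a => inr (u a) | inr b => inl b end.
exists r, (fun g => fsat phi (g \o s)); split; first exact: dfn_fsat.
exists w => // g; rewrite Dphi.
suff -> : fcat (g \o u) w = fsum w g \o s by [].
by apply: funext => i /=; rewrite /s /fcat; case: fintype.split.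
Qed.

Variable n : nat.
Local Notation vec := ('I_n -> C).

(* A question [exists z in P, psi z x nu] about the unknown tuple [x], where
   [nu] is an arbitrary tuple of parameters. *)
Record question := Question {
  q_size : nat;
  q_body : C -> vec -> ('I_q_size -> C) -> Prop;
  q_dfn : dfn set0 (fun g : option ('I_n + 'I_q_size) -> C =>
    q_body (g None) (g \o some \o inl) (g \o some \o inr)) }.

Arguments q_body q _ _ _ : clear implicits.

(** One [d] must serve all [x] in a set at once; where the question has no solution in [P] the
    condition is vacuous. *)
Definition answer (Psi : C -> vec -> Prop) (d : C) (x : vec) : Prop :=
  (exists2 z, PC z & Psi z x) -> Psi d x.

Lemma dfn_answer V (B : set C) (Psi : C -> vec -> Prop) (v : V) :
  dfn B (fun g : option 'I_n -> C => Psi (g None) (g \o some)) ->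
  dfn B (fun g : 'I_n + V -> C => answer Psi (g (inr v)) (g \o inl)).
Proof.
move=> dPsi; apply: dfn_imp.
  apply: (@dfn_ext _ _ _ _ (fun g => exists z, PC z /\ Psi z (g \o inl))).
    by move=> g; split=> [[z []]|[z]]; exists z.
  apply: (dfn_ex (D := fun z g => PC z /\ Psi z (g \o inl))).
  apply: dfn_and; first exact: dfn_P.
  exact: (dfn_var (fun o : option 'I_n => omap inl o) dPsi).
exact: (dfn_var (fun o : option 'I_n => oapp inl (inr v) o) dPsi).
Qed.

Lemma dfn_answer_question V (B : set C) (q : question) (d : V) (nu : 'I_(q_size q) -> V) :
  dfn B (fun g : 'I_n + V -> C =>
    answer (fun z x => q_body q z x (g \o inr \o nu)) (g (inr d)) (g \o inl)).
Proof.
have dq := dfn_sub (@sub0set _ B) (q_dfn q).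
apply: dfn_imp.
  apply: (@dfn_ext _ _ _ _ (fun g => exists z, PC z /\
      q_body q z (g \o inl) (g \o inr \o nu))).
    by move=> g; split=> [[z []]|[z]]; exists z.
  apply: (dfn_ex (D := fun z g => PC z /\ q_body q z (g \o inl) (g \o inr \o nu))).
  apply: dfn_and; first exact: dfn_P.
  exact: (dfn_var (fun x : option ('I_n + 'I_(q_size q)) => match x with
    None => None | Some (inl i) => Some (inl i)
    | Some (inr j) => Some (inr (nu j)) end) dq).
exact: (dfn_var (fun x : option ('I_n + 'I_(q_size q)) => match x with
    None => inr d | Some (inl i) => inl i | Some (inr j) => inr (nu j) end) dq).
Qed.

Lemma dfn_answer_param (B : set C) (Psi : C -> vec -> Prop) d : B d ->
  dfn B (fun g : option 'I_n -> C => Psi (g None) (g \o some)) ->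
  dfn B (answer Psi d).
Proof.
move=> Bd /(@dfn_answer unit _ _ tt) dA.
pose s (v : 'I_n + unit) : 'I_n + C := if v is inl i then inl i else inr d.
have sB v c : s v = inr c -> B c by case: v => //= _ [<-].
exact: dfn_ext (dfn_subst sB dA).
Qed.

Section Phi.
Variables (k : nat) (ph : vec -> ('I_k -> C) -> Prop).
Hypothesis dph : dfn set0 (fun g : 'I_n + 'I_k -> C => ph (g \o inl) (g \o inr)).

(* [rank w T]: the set [T] admits a tree of the shape prescribed by [w], in which
   [None] asks for a splitting of [T] by an instance of [ph], and [Some q]
   for the existence, for every choice of the parameters of [q], of an
   answer in [P] to the question [q]. *)
Fixpoint rank (w : seq (option question)) (T : vec -> Prop) : Prop :=
  match w with
  | [::] => exists x, T x
  | None :: w => exists m, rank w (fun x => T x /\ ph x m) /\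
                           rank w (fun x => T x /\ ~ ph x m)
  | Some q :: w => rank w T /\ ((exists p, PC p) -> forall nu, exists2 d, PC d &
      rank w (fun x => T x /\ answer (fun z x => q_body q z x nu) d x))
  end.

Lemma rank_sub w (T T' : vec -> Prop) : (forall x, T x -> T' x) -> rank w T -> rank w T'.
Proof.
elim: w T T' => [|[q|] w IH] T T' TT' /=.
- by move=> [x Tx]; exists x; exact: TT'.
- move=> [rT qT]; split; first exact: IH rT.
  move=> /qT + nu => /(_ nu)[d Pd rd]; exists d => //; apply: IH rd => x [/TT']; tauto.
- by move=> [m [r1 r2]]; exists m; split; [apply: IH r1 | apply: IH r2] => x [/TT'].
Qed.

Lemma rank_ex w (T : vec -> Prop) : rank w T -> exists x, T x.
Proof.
elim: w T => [|[q|] w IH] T //=; first by move=> [/IH].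
by move=> [m [/IH[x [Tx _]] _]]; exists x.
Qed.

(** With [rank_catr]: a concatenated word implies the conditions of both parts, so finitely many
    rank conditions follow from a single one, as compactness requires. *)
Lemma rank_catl u w (T : vec -> Prop) : rank (u ++ w) T -> rank u T.
Proof.
elim: u T => [|[q|] u IH] T /=; first exact: rank_ex.
  move=> [/IH rT qT]; split=> // p nu; have [d Pd rd] := qT p nu.
  by exists d => //; exact: IH.
by move=> [m [/IH r1 /IH r2]]; exists m.
Qed.

Lemma rank_catr u w (T : vec -> Prop) : rank (u ++ w) T -> rank w T.
Proof.
elim: u T => [|[q|] u IH] T //=; first by move=> [/IH].
by move=> [m [/IH r1 _]]; apply: rank_sub r1 => x [].
Qed.

Lemma dfn_rank V (B : set C) w (T : vec -> (V -> C) -> Prop) :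
  dfn B (fun g : 'I_n + V -> C => T (g \o inl) (g \o inr)) ->
  dfn B (fun g => rank w (fun x => T x g)).
Proof.
elim: w V T => [|[q|] w IH] V T dT /=.
- exact: (dfn_exv (D := T)).
- apply: dfn_and; first exact: IH.
  apply: dfn_imp; first exact: dfn_const.
  apply: (dfn_allv (D := fun nu g => exists2 d, PC d &
    rank w (fun x => T x g /\ answer (fun z x => q_body q z x nu) d x))).
  apply: (@dfn_ext _ _ _ _ (fun g => exists d, PC d /\
      rank w (fun x => T x (g \o inr) /\ answer (fun z x => q_body q z x (g \o inl)) d x))).
    by move=> g; split=> [[d []]|[d]]; exists d.
  apply: (dfn_ex (D := fun d g => PC d /\
      rank w (fun x => T x (g \o inr) /\ answer (fun z x => q_body q z x (g \o inl)) d x))).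
  apply: dfn_and; first exact: dfn_P.
  apply: (IH _ (fun x (g : option ('I_(q_size q) + V) -> C) => T x (g \o some \o inr) /\
    answer (fun z x => q_body q z x (g \o some \o inl)) (g None) x)).
  apply: dfn_and.
    exact: (dfn_var (fun x : 'I_n + V => match x with
      inl i => inl i | inr v => inr (Some (inr v)) end) dT).
  exact: (@dfn_answer_question (option ('I_(q_size q) + V)) B q None (fun j => Some (inl j))).
apply: (dfn_exv (D := fun m g => rank w (fun x => T x g /\ ph x m) /\
                           rank w (fun x => T x g /\ ~ ph x m))).
have dT' := dfn_var (fun x : 'I_n + V => match x with
      inl i => inl i | inr v => inr (inr v) end : 'I_n + ('I_k + V)) dT.
have dph' := dfn_var (fun x : 'I_n + 'I_k => match x with
      inl i => inl i | inr v => inr (inl v) end : 'I_n + ('I_k + V))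
   (dfn_sub (@sub0set _ B) dph).
apply: dfn_and.
  apply: (IH _ (fun x g => T x (g \o inr) /\ ph x (g \o inl))).
  exact: dfn_and dT' dph'.
apply: (IH _ (fun x g => T x (g \o inr) /\ ~ ph x (g \o inl))).
exact: dfn_and dT' (dfn_not dph').
Qed.

(* In the applications, [W] consists of all words,
   or only of the words without splittings. *)
Variable W : set (seq (option question)).
Hypothesis Wnil : W [::].
Hypothesis Wcat : forall u w, W u -> W w -> W (u ++ w).
Hypothesis Wask : forall q w, W w -> W (Some q :: w).

Definition conjl (l : seq (vec -> Prop)) (x : vec) := all_of (fun T => T x) l.

(** Infinite rank relative to [W], for partial types: the invariant of the transfinite
    constructions. *)
Definition good (pi : set (vec -> Prop)) :=
  forall w l, W w -> all_of pi l -> rank w (conjl l).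

Definition over (B : set C) (pi : set (vec -> Prop)) := forall T, pi T -> dfn B T.

Lemma conj_cat l l' x : conjl (l ++ l') x <-> conjl l x /\ conjl l' x.
Proof. exact: all_of_cat. Qed.

Lemma good_add pi (T : vec -> Prop) :
  (forall w l, W w -> all_of pi l -> rank w (fun x => conjl l x /\ T x)) ->
  good (pi `|` [set T]).
Proof.
move=> h w l Ww lp.
have [l' l'p ll'] : exists2 l', all_of pi l' & forall x, conjl l' x -> T x -> conjl l x.
  elim: l lp => [|U l IH] /=; first by exists [::].
  move=> [[pU|->] /IH[l' l'p ll']].
    by exists (U :: l') => // x [Ux /ll' h'] Tx; split=> //; exact: h'.
  by exists l' => // x l'x Tx; split=> //; exact: ll'.
by apply: rank_sub (h w l' Ww l'p) => x [l'x Tx]; exact: ll'.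
Qed.

Hypothesis hK : strongly_inaccessible K.
Hypothesis Csat : saturated K C.

Lemma dfn_conj V (B : set C) l pi : over B pi -> all_of pi l ->
  dfn B (fun g : 'I_n + V -> C => conjl l (g \o inl)).
Proof.
move=> oB; elim: l => [|T l IH] /=; first by move=> _; exact: dfn_true.
by move=> [/oB dT /IH dl]; apply: dfn_and => //; exact: (dfn_var inl dT).
Qed.

(** The parameters of [Psi] become the [nu] of a question [q]. Finitely many requirements on [d]
    follow from the one for a concatenated word [w], met because the finite parts of [pi] have rank
    at least [Some q :: w]. Saturation then gives one [d] for all words. *)
Lemma good_answer pi (B : set C) (Psi : C -> vec -> Prop) : sm K B -> over B pi ->
  good pi -> (exists p, PC p) ->
  dfn B (fun g : option 'I_n -> C => Psi (g None) (g \o some)) ->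
  exists2 d, PC d & good (pi `|` [set answer Psi d]).
Proof.
move=> sB oB gp Pne dPsi.
have [r [E [dE [nu nuB PsiE]]]] := dfn_params dPsi.
have PsiE' z x : Psi z x <-> E (fsum nu (oapp x z)).
  by rewrite -PsiE.
pose body z x nu := E (fsum nu (oapp x z)) : Prop.
have dbody : dfn set0 (fun g : option ('I_n + 'I_r) -> C =>
    body (g None) (g \o some \o inl) (g \o some \o inr)).
  have := dfn_var (fun v : 'I_r + option 'I_n => match v with
    inl i => Some (inr i) | inr None => None | inr (Some i) => Some (inl i) end) dE.
  apply: dfn_ext => g; rewrite /body; set g1 := (X in E X <-> _); set g2 := (X in _ <-> E X).
  by suff -> : g1 = g2 by []; apply: funext => -[|[]].
pose q := Question dbody.
have ansE d x : answer (fun z x => q_body q z x nu) d x <-> answer Psi d x.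
  by rewrite /answer /=; split=> h [z Pz] /PsiE' hz; apply/PsiE'; apply: h; exists z.
pose dG w l (h : 'I_1 -> C) := PC (h ord0) /\
  rank w (fun x => conjl l x /\ answer Psi (h ord0) x).
have [D [w [l [Ww lp ->]]]|ls lsG|h hG] := @saturation L K C Csat 1 B
    [set D | exists w l, [/\ W w, all_of pi l & D = dG w l]] sB.
- apply: dfn_and; first exact: dfn_P.
  apply: (@dfn_rank _ _ _ (fun x h => conjl l x /\ answer Psi (h ord0) x)).
  apply: dfn_and; first exact: dfn_conj oB lp.
  exact: (dfn_answer ord0 dPsi).
- suff [w [l [Ww lp lsP]]] : exists w l, [/\ W w, all_of pi l &
      forall h, dG w l h -> all_of (fun D => D h) ls].
    have [_ /(_ Pne nu)[d Pd rd]] : rank (Some q :: w) (conjl l) by apply: gp => //; exact: Wask.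
    exists (fun=> d); apply: lsP; split=> //; apply: rank_sub rd => x [lx].
    by rewrite ansE.
  elim: ls lsG => [|D ls IH] /=; first by move=> _; exists [::], [::].
  move=> [[w [l [Ww lp ->]]] /IH[w' [l' [Ww' lp' lsP]]]].
  exists (w ++ w'), (l ++ l'); split; first exact: Wcat.
    by apply/all_of_cat.
  move=> h [Ph rh]; split.
    split=> //; apply: rank_sub (rank_catl rh) => x [/conj_cat[]]; tauto.
  apply: lsP; split=> //; apply: rank_sub (rank_catr rh) => x [/conj_cat[]]; tauto.
exists (h ord0).
  by have [|] := hG (dG [::] [::]); first by exists [::], [::].
by apply: good_add => w l Ww lp; have [|] := hG (dG w l); first by exists w, l.
Qed.

Lemma good_split pi (B : set C) : (forall w, W w -> W (None :: w)) ->
  sm K B -> over B pi -> good pi ->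
  exists m, good (pi `|` [set ph^~ m]) /\ good (pi `|` [set (fun x => ~ ph x m)]).
Proof.
move=> Wsplit sB oB gp.
pose dG w l (m : 'I_k -> C) := rank w (fun x => conjl l x /\ ph x m) /\
                              rank w (fun x => conjl l x /\ ~ ph x m).
have [D [w [l [Ww lp ->]]]|ls lsG|m mG] := @saturation L K C Csat k B
    [set D | exists w l, [/\ W w, all_of pi l & D = dG w l]] sB.
- have dph' := dfn_sub (@sub0set _ B) dph.
  apply: dfn_and; [apply: (@dfn_rank _ _ _ (fun x m => conjl l x /\ ph x m)) |
                   apply: (@dfn_rank _ _ _ (fun x m => conjl l x /\ ~ ph x m))].
    by apply: dfn_and dph'; exact: dfn_conj oB lp.
  by apply: dfn_and (dfn_not dph'); exact: dfn_conj oB lp.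
- suff [w [l [Ww lp lsP]]] : exists w l, [/\ W w, all_of pi l &
      forall h, dG w l h -> all_of (fun D => D h) ls].
    have [m rm] : rank (None :: w) (conjl l) by apply: gp => //; exact: Wsplit.
    by exists m; exact: lsP.
  elim: ls lsG => [|D ls IH] /=; first by move=> _; exists [::], [::].
  move=> [[w [l [Ww lp ->]]] /IH[w' [l' [Ww' lp' lsP]]]].
  exists (w ++ w'), (l ++ l'); split; first exact: Wcat.
    by apply/all_of_cat.
  move=> h [r1 r2]; split; last apply: lsP.
    split; [apply: rank_sub (rank_catl r1)|apply: rank_sub (rank_catl r2)] => x [/conj_cat[]]; tauto.
  by split; [apply: rank_sub (rank_catr r1)|apply: rank_sub (rank_catr r2)] => x [/conj_cat[]]; tauto.
exists m; split; apply: good_add => w l Ww lp.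
  by have [|] := mG (dG w l); first by exists w, l.
by have [|] := mG (dG w l); first by exists w, l.
Qed.

(** * Transfinite recursion preserving infinite rank *)

Section Recursion.
Variables (V Y : Type) (lt : V -> V -> Prop) (wo : strict_wo lt).
Variables (pi : set (vec -> Prop)) (H : V -> Y -> set (vec -> Prop)).

Definition stage (S : set V) (g : V -> Y) : set (vec -> Prop) :=
  pi `|` \bigcup_(u in S) H u (g u).

(** Finite character: a finite list of conditions is already present at the largest index that
    occurs in it. *)
Lemma good_stage (S : set V) g : good pi ->
  (forall u, S u -> good (stage [set u' | lt u' u] g `|` H u (g u))) ->
  good (stage S g).
Proof.
move=> gp gS w l Ww lS.
have [lp|[u [Su lu]]] : all_of pi l \/ exists u, S u /\
    all_of (stage [set u' | lt u' u] g `|` H u (g u)) l.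
- elim: l lS => [|T l IH] /=; first by left.
  move=> [ST /IH{IH}[lp|[u [Su lu]]]].
    case: ST => [pT|[u Su uT]]; first by left.
    right; exists u; split=> //; split; first by right.
    by apply: all_of_sub lp => U pU; left; left.
  case: ST => [pT|[u' Su' uT]].
    by right; exists u; split=> //; split=> //; left; left.
  right; have [uu'|e|u'u] := swo_total wo u u'.
  + exists u'; split=> //; split; first by right.
    apply: all_of_sub lu => U [[pU|[v /= vu vU]]|uU]; left; first by left.
      by right; exists v => //=; exact: swo_trans uu'.
    by right; exists u.
  + by exists u; split=> //; split=> //; right; rewrite e.
  + by exists u; split=> //; split=> //; left; right; exists u'.
- exact: gp.
exact: (gS u).
Qed.

(** [Z] records what else is promised at [v]; it sees the set built so far, so that a promise may
    concern this set together with the new choice. *)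
Lemma good_recursion (y0 : Y) (Z : V -> set (vec -> Prop) -> Y -> Prop) :
  (forall v g, good (stage [set u | lt u v] g) ->
    (forall u, lt u v -> Z u (stage [set u' | lt u' u] g) (g u)) ->
    exists y, good (stage [set u | lt u v] g `|` H v y) /\
      Z v (stage [set u | lt u v] g) y) ->
  good pi -> exists g, good (stage setT g) /\
    forall v, Z v (stage [set u | lt u v] g) (g v).
Proof.
move=> ZP gp.
have stage_eq v g g' : (forall u, lt u v -> g u = g' u) ->
    stage [set u | lt u v] g = stage [set u | lt u v] g'.
  move=> gg'; congr (_ `|` _); apply: eq_bigcupr => u uv; by rewrite gg'.
have [v g g' y gg'|v g IH|g gP] := wf_rec_choice wo y0 (Q := fun v g y =>
    good (stage [set u | lt u v] g `|` H v y) /\ Z v (stage [set u | lt u v] g) y).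
- by rewrite (stage_eq _ _ _ gg').
- apply: ZP => [|u /IH[]//]; apply: good_stage => // u /IH[]//.
exists g; split=> [|v]; last by case: (gP v).
by apply: good_stage => // u _; case: (gP u).
Qed.
End Recursion.
End Phi.
End Rank.

Arguments q_body {L C n} q _ _ _.

(** * Chains of rich extensions *)

Section Ladder.
Variables (K F : Type).
Hypothesis hK : strongly_inaccessible K.
Hypothesis sF : sm K [set: F].

Lemma sm_seq (U : Type) : sm K [set: U] -> sm K [set: seq U].
Proof.
move=> sU; apply: (@sm_sub K _ _ (\bigcup_(n in [set: nat]) [set s : seq U | size s = n])).
  by move=> s _; exists (size s).
apply: (sm_bigcup hK); first exact: sm_nat.
move=> n _; elim: n => [|n IH].
  apply: (@sm_sub K _ _ ((fun=> [::]) @` [set: 'I_1])).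
    by move=> [|x s] // _; exists ord0.
  exact/sm_image/(sm_ord hK).
apply: (@sm_sub K _ _ ((fun p => p.1 :: p.2) @` ([set: U] `*` [set s | size s = n]))).
  by move=> [|x s] //= [sn]; exists (x, s).
exact/sm_image/(sm_prod hK).
Qed.

(* A well-ordered set in which every family indexed by [F] is strictly
   bounded: the least ordinal that does not embed in [seq F]. *)
Lemma ladder_exists : exists (I : Type) (lt : I -> I -> Prop),
  [/\ strict_wo lt, sm K [set: I], exists i : I, True
    & forall h : F -> I, exists i, forall f, lt (h f) i].
Proof.
pose W := set (seq F); have [lt wo] := strict_wo_exists W.
pose emb (S : set W) := exists h : W -> seq F, inj_on S h.
have nW : ~ emb setT.
  move=> [h hI]; pose Y0 := [set s | exists2 Y : W, h Y = s & ~ Y s] : W.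
  have [Yh|nYh] := pselect (Y0 (h Y0)).
    by have [Y /hI e nY] := Yh; apply: nY; rewrite e.
  by apply: (nYh); exists Y0.
have [S [Sdown nS Ssmall]] : exists S : set W, [/\ forall x y, lt x y -> S y -> S x,
    ~ emb S & forall x, S x -> emb [set y | lt y x]].
  have [[w nw]|allw] := pselect (exists w, ~ emb [set y | lt y w]); last first.
    exists setT; split=> // x _; apply: contrapT => nx; apply: allw; by exists x.
  elim/(well_founded_ind (swo_wf wo)): w nw => w IH nw.
  have [[v vw nv]|allv] := pselect (exists2 v, lt v w & ~ emb [set y | lt y v]).
    exact: IH nv.
  exists [set y | lt y w]; split=> //= [x y|x xw]; first exact: swo_trans.
  by apply: contrapT => nx; apply: allv; exists x.
have Sne : exists w, S w.
  apply: contrapT => Se; apply: nS; exists (fun=> [::]) => x y Sx; by case: Se; exists x.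
exists {x | S x}, (fun x y => lt (sval x) (sval y)); split.
- split.
  + move=> [x Sx]; elim/(well_founded_ind (swo_wf wo)): x Sx => x IH Sx.
    by constructor=> -[y Sy] /= yx; exact: IH.
  + by move=> [u ?] [v ?] [w ?] /=; exact: swo_trans.
  + move=> [u Su] [v Sv] /=; have [uv|e|vu] := swo_total wo u v.
    * exact: Or31.
    * by subst v; rewrite (Prop_irrelevance Su Sv); exact: Or32.
    * exact: Or33.
- by apply/sm_sig/(sm_sub (B := [set Y : W | Y `<=` setT])) => //; exact/(sm_pow hK)/sm_seq.
- by have [w Sw] := Sne; exists (exist _ w Sw).
(* If [h] is unbounded, each [w] in [S] is at most some [h f], so [f] and the code of [w] in the
   segment below [h f] determine [w]. This would embed [S] into [seq F]. *)
move=> h; apply: contrapT => nb; apply: nS.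
have [f0 _] : exists f : F, True.
  apply: contrapT => nf; apply: nb; have [w Sw] := Sne.
  by exists (exist _ w Sw) => f; case: nf; exists f.
have fP w : exists f, S w -> w = sval (h f) \/ lt w (sval (h f)).
  have [Sw|] := pselect (S w); last by exists f0.
  have [f nf] : exists f, ~ lt (sval (h f)) w.
    apply: contrapT => nf; apply: nb; exists (exist _ w Sw) => f /=.
    by apply: contrapT => nl; apply: nf; exists f.
  by exists f => _; have [||] := swo_total wo w (sval (h f)); auto.
have [phi phiP] := choice fP.
have eP f : exists e : W -> seq F, inj_on [set y | lt y (sval (h f))] e.
  exact/Ssmall/(svalP (h f)).
have [e eI] := choice eP.
(* The repetition of [phi w] makes the tail nonempty, which separates the two cases. *)
exists (fun w => phi w :: (if pselect (w = sval (h (phi w))) then [::]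
                           else phi w :: e (phi w) w)).
move=> w w' Sw Sw'; case: pselect => [wE|nw]; case: pselect => [w'E|nw'] // -[].
  by rewrite {2}wE {2}w'E => ->.
move=> pE _; rewrite pE; apply: eI => /=.
  by rewrite -pE; case: (phiP w Sw).
by case: (phiP w' Sw').
Qed.
End Ladder.

Section Chains.
Variables (L : language) (P : rel_sym L) (K : Type) (C : structure L).
Local Notation dfn := (@dfn L C _).
Local Notation F := {n & formula L n}.
Hypothesis hK : strongly_inaccessible K.
Hypothesis sF : sm K [set: F].

Lemma sm_codes V (A : set C) : sm K [set: V] -> sm K A ->
  sm K [set x : code C V | cpar x `<=` A].
Proof.
move=> sV sA; apply: (@sm_sub K _ _ (\bigcup_(f in [set: F])
  (fun x => Code (projT2 f) x) @` [set x | range x `<=` range inl `|` inr @` A])).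
  move=> [n phi x] xA; exists (existT _ n phi) => //; exists x => // _ [i _ <-].
  by case e: (x i) => [v|c]; [left; exists v | right; exists c => //; apply: xA; exists i].
apply: (sm_bigcup hK) => // f _; apply: sm_image; apply: (sm_fun hK).
  exact: (sm_ord hK).
by apply: (sm_setU hK); exact: sm_image.
Qed.

Definition same_type (A : set C) V (g g' : V -> C) :=
  forall D : (V -> C) -> Prop, dfn A D -> (D g <-> D g').

Definition realized (A : set C) V (S : set C) :=
  forall g : V -> C, exists2 g', range g' `<=` S & same_type A g g'.

Lemma realized_exists (A : set C) V : sm K A -> sm K [set: V] ->
  exists2 S, sm K S & realized A V S.
Proof.
move=> sA sV.
have [[g0 _]|ng] := pselect (exists g : V -> C, True); last first.
  by exists A => // g; case: ng; exists g.
pose typ (g : V -> C) := [set x : code C V | cpar x `<=` A /\ csat x g].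
pose rep t := some_in g0 (fun g => typ g = t).
exists (\bigcup_(t in [set t | t `<=` [set x : code C V | cpar x `<=` A]]) range (rep t)).
  apply: (sm_bigcup hK); first exact/(sm_pow hK)/sm_codes.
  by move=> t _; exact: sm_image.
move=> g; have e : typ (rep (typ g)) = typ g by apply: (@some_inP _ g0 (fun g' => typ g' = typ g)); exists g.
exists (rep (typ g)) => [c [v _ <-]|D [x xA Dx]].
  by exists (typ g); [move=> x [] | exists v].
rewrite !Dx; split=> h.
  by have [] : typ (rep (typ g)) x by rewrite e.
by have [] : typ g x by rewrite -e.
Qed.

Lemma realized_sub A V S S' : S `<=` S' -> realized A V S -> realized A V S'.
Proof. by move=> SS' r g; have [g' g'S] := r g; exists g' => //; exact: subset_trans SS'. Qed.

Lemma realized_inj A V V' S (i : V' -> V) : injective i -> realized A V S -> realized A V' S.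
Proof.
move=> iI r g; have [[v0 _]|nv] := pselect (exists v : V', True); last first.
  exists g => [c [v]|D _]; first by case: nv; exists v.
  by [].
pose gx v := g (some_in v0 (fun v' => i v' = v)).
have gxE : gx \o i = g.
  apply: funext => v /=; rewrite /gx; congr g; apply: iI.
  by apply: (@some_inP _ v0 (fun v' => i v' = i v)); exists v.
have [g' g'S gg'] := r gx; exists (g' \o i) => [c [v _ <-]|D dD]; first by apply: g'S; exists (i v).
by rewrite -{1}gxE; exact: (gg' (fun h => D (h \o i)) (dfn_var i dD)).
Qed.

(** The variables are numbered by [nat] because an extension of [A] that holds all answers must be
    fixed before the tuples that the questions are about. *)
Definition task (A : set C) := {x : code C nat | cpar x `<=` A}.

(* There are more families than functions from [F] to [A], the possible values
   of an injective coding of [S_*(N)] bounded at a stage of a chain. *)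
Definition bounded_fam (A : set C) := {Y : set (F -> C) | forall h, Y h -> range h `<=` A}.

(** Families indexed by [task A] hold one answer for each question; those indexed by
    [bounded_fam A * nat] hold one tuple of parameters for each splitting. *)
Definition rich (A S : set C) :=
  [/\ A `<=` S, realized A (task A) S & realized A (bounded_fam A * nat) S].

Lemma sm_bounded_fam A : sm K A -> sm K [set: bounded_fam A].
Proof.
move=> sA; apply: sm_sig; apply: sm_sub (sm_pow hK (sm_fun hK sF sA)) => Y YA h Yh.
exact: YA.
Qed.

Lemma rich_exists A : sm K A -> exists2 S, sm K S & rich A S.
Proof.
move=> sA.
have [S1 sS1 r1] : exists2 S, sm K S & realized A (task A) S.
  by apply: realized_exists => //; apply/sm_sig/sm_codes => //; exact: sm_nat.
have [S2 sS2 r2] : exists2 S, sm K S & realized A (bounded_fam A * nat) S.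
  apply: realized_exists => //.
  apply: (@sm_sub K _ _ ([set: bounded_fam A] `*` [set: nat])) => //.
  by apply: (sm_prod hK); [exact: sm_bounded_fam | exact: sm_nat].
exists (A `|` (S1 `|` S2)); first by do !apply: (sm_setU hK).
split; first by move=> c; left.
  by apply: realized_sub r1 => c; right; left.
by apply: realized_sub r2 => c; right; right.
Qed.

Lemma rich_fin A S k : rich A S -> realized A 'I_k S.
Proof.
move=> [_ _]; have h0 (h : F -> C) : set0 h -> range h `<=` A by [].
apply: (@realized_inj _ _ _ _ (fun i => (exist _ set0 h0 : bounded_fam A, nat_of_ord i))).
by move=> i j [] /val_inj.
Qed.

Lemma rich_point A S k (D : ('I_k -> C) -> Prop) : rich A S -> dfn A D ->
  (exists h, D h) -> exists2 h, range h `<=` S & D h.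
Proof.
move=> r dD [h Dh]; have [h' h'S hh'] := rich_fin r h.
by exists h' => //; exact/(hh' _ dD).
Qed.

Variables (I : Type) (lt : I -> I -> Prop).
Hypothesis wo : strict_wo lt.
Hypothesis sI : sm K [set: I].
Hypothesis Ine : exists i : I, True.
Hypothesis Ibound : forall h : F -> I, exists i, forall f, lt (h f) i.

Lemma ladder_fin n (h : 'I_n -> I) : exists i, forall j, lt (h j) i.
Proof.
have [i0 _] := Ine.
(* The formulas [Bot], one for each number of variables, embed finite index sets into [F]. *)
pose h' (f : F) := if @insub _ (fun m => m < n)%N _ (projT1 f) is Some j then h j else i0.
have [i iP] := Ibound h'; exists i => j.
have := iP (existT _ (j : nat) (Bot L j)); rewrite /h' /= insubT //= => lj.
by rewrite (_ : Sub _ _ = j) //; exact: val_inj.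
Qed.

Lemma ladder_next i j : exists i', lt i i' /\ lt j i'.
Proof.
have [i' i'P] := ladder_fin (fun b : 'I_2 => if b == ord0 then i else j).
by exists i'; split; [have := i'P ord0 | have := i'P ord_max].
Qed.

(* At every step, the first rich extension provides the parameters of the
   splittings and the traces, the second one the answers to the questions. *)
Definition ladder (N : set C) (A : I -> set C) :=
  [/\ forall i, sm K (A i), N = \bigcup_i A i, forall i j, lt i j -> A i `<=` A j
    & forall i, exists S S',
      [/\ rich (A i) S, rich S S' & forall j, lt i j -> S' `<=` A j]].

Definition special (N : set C) := exists A, ladder N A.

Lemma special_exists (M : set C) : sm K M -> exists2 N, special N & M `<=` N.
Proof.
move=> sM; pose below i (g : I -> set C) := M `|` \bigcup_(j in [set j | lt j i]) g j.
have [i g g' y gg'|i g IH|g gP] := wf_rec_choice wo (set0 : set C) (Q := fun i g B =>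
    sm K B /\ exists S, rich (below i g) S /\ rich S B).
- suff -> : below i g = below i g' by [].
  by congr (_ `|` _); apply: eq_bigcupr => u uv; rewrite gg'.
- have sb : sm K (below i g).
    apply: (sm_setU hK) => //; apply: (sm_bigcup hK) => [|j /IH[]//].
    exact: sm_sub sI.
  have [S sS rS] := rich_exists sb; have [S' sS' rS'] := rich_exists sS.
  by exists S'; split=> //; exists S.
exists (\bigcup_i below i g); last by have [i _] := Ine; move=> c Mc; exists i => //; left.
exists (below^~ g); split=> //.
- move=> i; apply: (sm_setU hK) => //; apply: (sm_bigcup hK) => [|j _]; last by case: (gP j).
  exact: sm_sub sI.
- move=> i j ij c [Mc|[u /= ui gu]]; first by left.
  by right; exists u => //=; exact: swo_trans ij.
move=> i; have [_ [S [rS rS']]] := gP i.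
by exists S, (g i); split=> // j ij c gc; right; exists i.
Qed.

Lemma ladder_sm N A : ladder N A -> sm K N.
Proof. by move=> [sA -> _ _]; apply: (sm_bigcup hK). Qed.

Lemma ladder_le N A i : ladder N A -> A i `<=` N.
Proof. by move=> [_ -> _ _] c Ac; exists i. Qed.

Lemma ladder_code N A V (x : code C V) : ladder N A -> cpar x `<=` N ->
  exists i, cpar x `<=` A i.
Proof.
move=> [_ -> incr _] xN; have [i0 _] := Ine.
have hP j : exists i, forall c, code_var x j = inr c -> A i c.
  case e: (code_var x j) => [v|c]; first by exists i0.
  have [|i _ Ac] := xN c; first by exists j.
  by exists i => _ [<-].
have [h hA] := choice hP; have [i iP] := ladder_fin h.
by exists i => c [j /hA Ac]; exact: incr (iP j) _ Ac.
Qed.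

Lemma ladder_dfn N A V (D : (V -> C) -> Prop) : ladder N A -> dfn N D ->
  exists i, dfn (A i) D.
Proof.
by move=> lA [x /(ladder_code lA)[i xA] Dx]; exists i, x.
Qed.

Lemma ladder_TV N A : ladder N A -> TV N.
Proof.
move=> lA k D /(ladder_dfn lA)[i dD] Dne; have [j [ij _]] := ladder_next i i.
have [_ _ _ /(_ i)[S [S' [rS [SS' _ _] S'A]]]] := lA.
have [h hS Dh] := rich_point rS dD Dne; exists h => // c /hS /SS' /(S'A j ij).
exact: ladder_le lA _.
Qed.
End Chains.

(** * Answering all questions over a set at once *)

Section Tasks.
Variables (L : language) (P : rel_sym L) (K : Type) (C : structure L).
Local Notation PC := (Pset P C).
Local Notation dfn := (@dfn L C _).
Local Notation F := {n & formula L n}.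
Hypothesis hK : strongly_inaccessible K.
Hypothesis sF : sm K [set: F].
Hypothesis Csat : saturated K C.

Section Questions.
Variables (n r : nat) (e : 'I_r -> C).
Local Notation vec := ('I_n -> C).

(* Questions about [x] with parameters [e] and parameters from [A] are coded
   over [nat], so that their number depends on [A] only. *)
Definition slot (i : nat) : option ('I_n + 'I_r) := odflt None (unpickle i).

Definition number (o : option ('I_n + 'I_r)) : nat := pickle o.

Lemma numberK : cancel number slot.
Proof. by move=> o; rewrite /slot /number pickleK. Qed.

Definition asked (x : code C nat) (z : C) (y : vec) : Prop :=
  csat x (fun i => oapp (fsum y e) z (slot i)).

Lemma dfn_asked (B : set C) (x : code C nat) : cpar x `<=` B -> range e `<=` B ->
  dfn B (fun g : option 'I_n -> C => asked x (g None) (g \o some)).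
Proof.
move=> xB eB.
pose s i : option 'I_n + C := match slot i with
  None => inl None | Some (inl j) => inl (Some j) | Some (inr j) => inr (e j) end.
have sB i c : s i = inr c -> B c.
  by rewrite /s; case: (slot i) => [[j|j]|] // [<-]; apply: eB; exists j.
have dx : dfn B (csat x) by exists x.
apply: dfn_ext (dfn_subst sB dx) => g; rewrite /asked.
suff -> : fsum g id \o s = (fun i => oapp (fsum (g \o some) e) (g None) (slot i)) by [].
by apply: funext => i /=; rewrite /s; case: (slot i) => [[]|].
Qed.

Lemma asked_code (N : set C) (y : vec) (D : C -> Prop) :
  dfn ((N `|` range e) `|` range y) (fun g : unit -> C => D (g tt)) ->
  exists2 x : code C nat, cpar x `<=` N & forall z, D z <-> asked x z y.
Proof.
move=> /dfn_sep[D1 /dfn_sep[D2 dD2 D12] D1E].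
pose s (v : 'I_r + ('I_n + unit)) : nat := match v with
  inl j => number (Some (inr j)) | inr (inl j) => number (Some (inl j))
  | inr (inr _) => number None end.
have [x xN Dx] := dfn_var s dD2; exists x => // z.
rewrite (D1E (fun=> z)) D12 /asked -Dx.
set g1 := fsum _ _; set g2 := _ \o s.
suff -> : g1 = g2 by [].
by apply: funext => -[j|[j|[]]]; rewrite /g1 /g2 /s /= ?numberK.
Qed.
End Questions.

Section Good.
Variables (n k : nat) (ph : ('I_n -> C) -> ('I_k -> C) -> Prop).
Local Notation vec := ('I_n -> C).
Hypothesis dph : dfn set0 (fun g : 'I_n + 'I_k -> C => ph (g \o inl) (g \o inr)).
Variable W : set (seq (option (question C n))).
Hypothesis Wnil : W [::].
Hypothesis Wcat : forall u w, W u -> W w -> W (u ++ w).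
Hypothesis Wask : forall q w, W w -> W (Some q :: w).
Local Notation good := (good P ph W).

(** The answers are first chosen one by one anywhere in [P], then replaced together by a family in
    [S] of the same type over [A']. The rank conditions have parameters in [B], but on answers from
    [P] they coincide with their traces, which are over [A'] and hence preserved. *)
Lemma good_answers r (e : 'I_r -> C) (A A' B S : set C) (pi : set (vec -> Prop)) :
  sm K A -> sm K B -> A `<=` A' -> rich A' S -> A `<=` B -> range e `<=` B ->
  traced P A' B -> (exists p, PC p) -> over B pi -> good pi ->
  exists2 d : code C nat -> C, forall x, cpar x `<=` A -> PC (d x) /\ S (d x) &
    good (pi `|` [set T | exists2 x, cpar x `<=` A & T = answer P (asked e x) (d x)]).
Proof.
move=> sA sB AA' [_ rS _] AB eB tr Pne oB gp.
have [lt wo] := strict_wo_exists (task A).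
have sT : sm K [set: task A] by apply/sm_sig/(sm_codes hK sF) => //; exact: sm_nat.
have dask (v : task A) B' : B `<=` B' ->
    dfn B' (fun g : option 'I_n -> C => asked e (sval v) (g None) (g \o some)).
  move=> BB'; apply: dfn_asked; last exact: subset_trans BB'.
  by apply: subset_trans (svalP v) _; exact: subset_trans BB'.
have [p0 Pp0] := Pne.
pose H (v : task A) (d : C) : set (vec -> Prop) := [set answer P (asked e (sval v)) d].
have [v g gst _|g [gst gP]] := good_recursion wo (H := H) p0 (Z := fun v st d => PC d) _ gp.
  have oB' : over (B `|` range g) (stage pi H [set u | lt u v] g).
    move=> T [/oB|[u _ ->]]; first by apply: dfn_sub; exact: subsetUl.
    apply: dfn_answer_param; first by right; exists u.
    by apply: dask; exact: subsetUl.
  have [|d Pd gd] := good_answer dph Wnil Wcat Wask Csat _ oB' gst Pne (dask v _ (@subsetUl _ _ _)).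
    by apply: (sm_setU hK) => //; exact: sm_image.
  by exists d.
have incl : injective (fun v : task A => exist _ (sval v) (subset_trans (svalP v) AA') : task A').
  by move=> [u uA] [v vA] [uv]; exact: eq_exist.
have [g' g'S gg'] := realized_inj incl rS g.
have g'P v : PC (g' v) by have [+ _] := gg' _ (dfn_P P A' v); apply; exact: gP.
exists (fun x => if pselect (cpar x `<=` A) is left h then g' (exist _ x h) else p0).
  move=> x xA; case: pselect => // h; split; first exact: g'P.
  by apply: g'S; exists (exist _ x h).
move=> w l Ww ls.
pose ans (g : task A -> C) (vs : seq (task A)) (y : vec) : Prop := all_of (fun v => answer P (asked e (sval v)) (g v) y) vs.
have [l' [vs [l'p ll']]] : exists l' vs, all_of pi l' /\
    forall y, conjl l' y -> ans g' vs y -> conjl l y.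
  elim: l ls => [|T l IH] /=; first by exists [::], [::].
  move=> [[pT|[x xA ->]] /IH[l' [vs [l'p ll']]]].
    by exists (T :: l'), vs; split=> // y [Ty l'y] ay; split=> //; exact: ll'.
  exists l', (exist _ x xA :: vs); split=> // y l'y [ay avs]; split; last exact: ll'.
  by case: pselect => // h; rewrite (Prop_irrelevance h xA).
suff : rank P ph w (fun y => conjl l' y /\ ans g' vs y) by apply: rank_sub => y []; exact: ll'.
have [|E' dE' EE'] := tr _ (fun g => rank P ph w (fun y => conjl l' y /\ ans g vs y)).
  apply: (@dfn_rank L P C n k ph dph _ _ _ (fun y g => conjl l' y /\ ans g vs y)).
  apply: dfn_and; first exact: dfn_conj oB l'p.
  rewrite /ans; elim: vs {ll'} => [|v vs IH] /=; first exact: dfn_true.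
  apply: dfn_and => //; apply: dfn_answer; exact: dask.
have PE h : (forall v, PC (h v)) -> range h `<=` PC by move=> Ph _ [v _ <-].
rewrite EE'; last exact: PE.
rewrite -(gg' _ dE') -EE'; last exact: PE.
have : rank P ph w (conjl (l' ++ [seq answer P (asked e (sval v)) (g v) | v <- vs])).
  apply: gst => //; apply/all_of_cat; split; first by apply: all_of_sub l'p => T; left.
  by apply/all_of_map/all_of_true => v; right; exists v.
by apply: rank_sub => y /conj_cat[l'y /all_of_map].
Qed.

End Good.
End Tasks.

(** * Finiteness of the rank *)

Section Counting.
Variables (L : language) (P : rel_sym L) (K : Type) (C : structure L).
Local Notation PC := (Pset P C).
Local Notation dfn := (@dfn L C _).
Local Notation F := {n & formula L n}.
Hypothesis hK : strongly_inaccessible K.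
Hypothesis sF : sm K [set: F].
Hypothesis Csat : saturated K C.
Variables (n k : nat) (ph : ('I_n -> C) -> ('I_k -> C) -> Prop).
Local Notation vec := ('I_n -> C).
Hypothesis dph : dfn set0 (fun g : 'I_n + 'I_k -> C => ph (g \o inl) (g \o inr)).
Local Notation good := (good P ph setT).

Lemma dfn_instance (B : set C) m : range m `<=` B -> dfn B (ph^~ m).
Proof.
move=> mB; pose s (v : 'I_n + 'I_k) : 'I_k + 'I_n := match v with
  inl i => inr i | inr j => inl j end.
have := dfn_glue (dfn_var s dph) (@sub0set _ B) mB.
by apply: dfn_ext => g.
Qed.

(** A comb instead of a tree: each splitting continues on its positive side and leaves the negative
    side as an exit. The exits are pairwise inconsistent, so there are as many of them as elements
    of [bounded_fam A]. The rank conditions are over [A], so all parameters move into [S]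
    together. *)
Lemma good_splits (A S : set C) (pi : set (vec -> Prop)) (ltX : bounded_fam A -> bounded_fam A -> Prop) :
  strict_wo ltX -> (exists m : 'I_k -> C, True) ->
  sm K A -> rich A S -> over A pi -> good pi ->
  exists2 m : bounded_fam A -> 'I_k -> C, forall u, range (m u) `<=` S &
    forall u, good (stage pi (fun _ a => [set ph^~ a]) [set u' | ltX u' u] m
                    `|` [set (fun x => ~ ph x (m u))]).
Proof.
move=> wo [m0 _] sA [AS _ rS] oA gp.
have sX := sm_bounded_fam hK sF sA.
pose H (u : bounded_fam A) (a : 'I_k -> C) : set (vec -> Prop) := [set ph^~ a].
have [u g gst _|g [_ gP]] := good_recursion wo (H := H) m0
    (Z := fun u st a => good (st `|` [set (fun x => ~ ph x a)])) _ gp.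
  pose B := A `|` \bigcup_v range (g v).
  have sB : sm K B.
    apply: (sm_setU hK) => //; apply: (sm_bigcup hK) => // v _; exact: (sm_range_ord hK).
  have oB : over B (stage pi H [set v | ltX v u] g).
    move=> T [/oA|[v _ ->]]; first by apply: dfn_sub; exact: subsetUl.
    by apply: dfn_instance => c cv; right; exists v.
  have [m [m1 m2]] := @good_split L P K C n k ph dph setT I (fun _ _ _ _ => I) Csat _ _
    (fun _ _ => I) sB oB gst.
  by exists m.
pose ix (p : bounded_fam A * 'I_k) : bounded_fam A * nat := (p.1, nat_of_ord p.2).
have ixI : injective ix by move=> [u i] [v j] [-> /val_inj ->].
have [g' g'S gg'] := realized_inj ixI rS (fun p => g p.1 p.2).
exists (fun u j => g' (u, j)) => [u c [j _ <-]|u w l Ww ls].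
  by apply: g'S; exists (u, j).
pose above (g : bounded_fam A * 'I_k -> C) (vs : seq (bounded_fam A)) (x : vec) : Prop :=
  all_of (fun v => ph x (fun j => g (v, j))) vs /\ ~ ph x (fun j => g (u, j)).
have [l' [vs [l'p vsu ll']]] : exists l' vs, [/\ all_of pi l', all_of (ltX^~ u) vs &
    forall x, conjl l' x -> above g' vs x -> conjl l x].
  elim: l ls => [|T l IH] /=; first by exists [::], [::].
  move=> [[[pT|[v /= vu ->]]|->] /IH[l' [vs [l'p vsu ll']]]].
  - by exists (T :: l'), vs; split=> // x [Tx l'x] ax; split=> //; exact: ll'.
  - exists l', (v :: vs); split=> // x l'x [[vx vsx] ux]; split=> //; exact: ll'.
  - exists l', vs; split=> // x l'x ax; split; last exact: ll'.
    by case: ax.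
suff : rank P ph w (fun x => conjl l' x /\ above g' vs x).
  by apply: rank_sub => x []; exact: ll'.
have dab : dfn A (fun g => rank P ph w (fun x => conjl l' x /\ above g vs x)).
  apply: (@dfn_rank L P C n k ph dph _ _ _ (fun x g => conjl l' x /\ above g vs x)).
  have dv v : dfn A (fun g : 'I_n + bounded_fam A * 'I_k -> C =>
      ph (g \o inl) (fun j => g (inr (v, j)))).
    exact: (dfn_var (fun y : 'I_n + 'I_k => match y with
      inl i => inl i | inr j => inr (v, j) end) (dfn_sub (@sub0set _ A) dph)).
  apply: dfn_and; first exact: dfn_conj oA l'p.
  apply: dfn_and; last by apply: dfn_not; exact: dv.
  elim: (vs) => [|v vs' IH] /=; first exact: dfn_true.
  by apply: dfn_and IH; exact: dv.
have [+ _] := gg' _ dab; apply.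
have : rank P ph w (conjl (l' ++ [seq ph^~ (g v) | v <- vs] ++ [:: fun x => ~ ph x (g u)])).
  apply: (gP u) => //; apply/all_of_cat; split; last (apply/all_of_cat; split).
  - by apply: all_of_sub l'p => T; left; left.
  - by apply/all_of_map; apply: all_of_sub vsu => v vu; left; right; exists v.
  - by split=> //; right.
apply: rank_sub => x /conj_cat[l'x /conj_cat[/all_of_map vsx [ux _]]]; by [].
Qed.

Variables (J : Type) (lt : J -> J -> Prop).
Hypothesis wo : strict_wo lt.
Hypothesis sI : sm K [set: J].
Hypothesis Ine : exists i : J, True.
Hypothesis Ibound : forall h : F -> J, exists i, forall f, lt (h f) i.
Hypothesis H3 : hypothesis_H3 P K C.
Local Notation ladder := (ladder K lt).

(** The definition of stability is applied with [N] itself as the equivalent set; [N] is a small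
    model by [ladder_TV]. *)
Lemma stable_injection (c0 : C) (N : set C) (A : J -> set C) : ladder N A ->
  exists2 e : ntype C n -> F -> C, forall p, S_star P N p -> range (e p) `<=` N &
    inj_on [set p | S_star P N p] e.
Proof.
move=> lA; have sN := ladder_sm hK sI lA.
have [_ /(_ N (sm_small sN))] := H3 (conj (sm_small sN) (elementary_TV (ladder_TV Ine Ibound lA))).
set X := [set p : {n & ntype C n} | _].
move=> /(_ (fun _ => iff_refl _))/card_le_fun[f fI].
pose val_of p (h : S_star P N p) := val (f (SigSub (mem_set (h : X (existT _ n p))))) : F -> C.
exists (fun p => if pselect (S_star P N p) is left h then val_of p h else fun=> c0).
  by move=> p Sp; case: pselect => // h; exact: (set_mem (valP (f _))).
move=> p p' Sp Sp'; case: pselect => // h; case: pselect => // h' /val_inj /fI [].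
exact: (inj_pair2_eq_dec nat (@eq_comparable nat)).
Qed.

(** Cantor's argument. If every exit [u] were taken by a type with code in [A i], inconsistency of
    the exits would make the codes distinct, and sets of functions from [F] to [A i] would inject
    into such functions. *)
Lemma exists_avoided (c0 : C) N A i S (m : bounded_fam (A i) -> 'I_k -> C)
    (ltX : bounded_fam (A i) -> bounded_fam (A i) -> Prop) (e : ntype C n -> F -> C) :
  ladder N A -> strict_wo ltX -> inj_on [set p | S_star P N p] e ->
  S `<=` N -> (forall u, range (m u) `<=` S) ->
  exists u, forall c : n.-tuple C, S_star P N (tp c N) -> range (e (tp c N)) `<=` A i ->
    ~ ((forall v, ltX v u -> ph (tnth c) (m v)) /\ ~ ph (tnth c) (m u)).
Proof.
move=> lA woX eI SN mS; apply: contrapT => nu.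
pose bad u (c : n.-tuple C) := [/\ S_star P N (tp c N), range (e (tp c N)) `<=` A i,
  forall v, ltX v u -> ph (tnth c) (m v) & ~ ph (tnth c) (m u)].
have bP u : exists c, bad u c.
  apply: contrapT => nb; apply: nu; exists u => c Sc rc [h1 h2]; apply: nb; by exists c.
have [c cP] := choice bP.
have dm u : dfn N (ph^~ (m u)) by apply: dfn_instance; exact: subset_trans (mS u) SN.
pose h u := e (tp (c u) N).
have hI u v : h u = h v -> u = v.
  have [Su _ u1 u2] := cP u; have [Sv _ v1 v2] := cP v => /(eI _ _ Su Sv) E.
  have [uv|//|vu] := swo_total woX u v.
    by case: u2; apply: (tp_dfn (esym E) (dm u)); exact: v1.
  by case: v2; apply: (tp_dfn E (dm v)); exact: u1.
have Y0A g : (exists2 u, h u = g & ~ sval u g) -> range g `<=` A i.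
  by move=> [u <- _]; case: (cP u).
pose u0 : bounded_fam (A i) := exist _ [set g | exists2 u, h u = g & ~ sval u g] Y0A.
have [Yu|nYu] := pselect (sval u0 (h u0)).
  by have [u /hI e' nu0] := Yu; apply: nu0; rewrite e'.
by apply: (nYu); exists u0.
Qed.

Lemma rank_bounded : exists w, ~ rank P ph w (fun=> True).
Proof.
apply: contrapT => nw.
have rT w : rank P ph w (fun=> True) by apply: contrapT => h; apply: nw; exists w.
(* Over an empty structure all tuples of a given length coincide, and nothing can be split. *)
have [c0 _] : exists c : C, True.
  apply: contrapT => nC; have [m [[x [_ px]] [x' [_ npx]]]] := rT [:: None].
  apply: npx; rewrite (_ : x' = x) //; apply: funext => i.
  by case: nC; exists (x i).
have [N [A lA] _] := special_exists hK sF wo sI Ine (sm0 hK (U := C)).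
have [e eN eI] := stable_injection c0 lA.
pose e0 (i : 'I_0) : C := c0.
(* Promises of stage [i]: its conditions have parameters in all later sets, every question over
   [A i] has an answer in [N], and no type in [S_*(N)] with code in [A i] satisfies all its
   conditions. *)
pose Z (i : J) (st y : set (vec -> Prop)) := [/\ forall j, lt i j -> over (A j) y,
  (exists p, PC p) -> forall x : code C nat, cpar x `<=` A i ->
    exists2 d, PC d /\ N d & y (answer P (asked e0 x) d)
  & forall c : n.-tuple C, S_star P N (tp c N) -> range (e (tp c N)) `<=` A i ->
    ~ forall T : vec -> Prop, y T -> T (tnth c)].
pose H (i : J) (y : set (vec -> Prop)) := y.
have [i g gst gZ||g [gst gZ]] := good_recursion wo (pi := set0) (H := H) set0 (Z := Z) (W := setT) (ph := ph) (P := P).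
- have [j [ij _]] := ladder_next Ine Ibound i i.
  have [sA NE incr steps] := lA.
  have [S [S' [rS rS' S'A]]] := steps i; have S'j := S'A j ij.
  have [AS _ _] := rS; have [SS' _ _] := rS'.
  have S'N : S' `<=` N by apply: subset_trans S'j (ladder_le lA).
  have oA : over (A i) (stage set0 H [set u | lt u i] g).
    by move=> T [//|[u ui uT]]; have [o _ _] := gZ u ui; exact: o uT.
  have [ltX woX] := strict_wo_exists (bounded_fam (A i)).
  have [m mS mP] := good_splits woX (ex_intro _ (fun=> c0) Logic.I) (sA i) rS oA gst.
  have [u uP] := exists_avoided c0 lA woX eI (subset_trans SS' S'N) mS.
  pose st := stage set0 H [set u | lt u i] g.
  pose pi1 := stage st (fun _ a => [set ph^~ a]) [set v | ltX v u] m
                `|` [set (fun x => ~ ph x (m u))].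
  have gpi1 : good pi1 := mP u.
  have sS : sm K S by apply: sm_sub (sA j); exact: subset_trans S'j.
  have opi1 : over S pi1.
    move=> T [[sT|[v _ ->]]|->].
    - by apply: (dfn_sub AS); exact: oA.
    - exact: dfn_instance.
    - by apply: dfn_not; exact: dfn_instance.
  have avoid (c : n.-tuple C) : S_star P N (tp c N) -> range (e (tp c N)) `<=` A i ->
      ~ forall T : vec -> Prop, pi1 T -> T (tnth c).
    move=> Sc rc cpi1; case: (uP c Sc rc); split=> [v vu|].
      by apply: (cpi1 (ph^~ (m v))); left; right; exists v.
    by apply: (cpi1 (fun x => ~ ph x (m u))); right.
  have st1 : st `<=` pi1 by move=> T sT; left; left.
  have absorb y : pi1 `<=` y -> st `|` H i y = y.
    move=> pi1y; apply/seteqP; split=> T; last by right.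
    by case=> // sT; apply: pi1y; exact: st1.
  have [Pne|Pe] := pselect (exists p, PC p); last first.
    exists pi1; split; first by rewrite absorb.
    split=> // j' ij' T /opi1; apply: dfn_sub.
    by apply: subset_trans (S'A j' ij').
  have e0S : range e0 `<=` S by move=> c [[]].
  (* Without parameters outside [N], the traces are given by the formulas themselves. *)
  have trS : traced P S S by move=> V D dD; exists D.
  have [d dP gd] := good_answers hK sF Csat dph (W := setT) I (fun _ _ _ _ => I)
    (fun _ _ _ => I) (e := e0) (sA i) sS AS rS' AS e0S trS Pne opi1 gpi1.
  exists (pi1 `|` [set T | exists2 x, cpar x `<=` A i & T = answer P (asked e0 x) (d x)]).
  split; first by rewrite absorb //; exact: subsetUl.
  split=> [j' ij' T|_ x xA|c Sc rc cT].
  - case=> [/opi1|[x xA ->]].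
      by apply: dfn_sub; exact: subset_trans (S'A j' ij').
    apply: dfn_answer_param; first by apply: (S'A j' ij'); case: (dP x xA).
    by apply: dfn_asked => [c /xA /AS /SS'|c [[]]//]; exact: S'A.
  - have [Pd Sd] := dP x xA; exists (d x); first by split=> //; exact: S'N.
    by right; exists x.
  - by apply: (avoid c Sc rc) => T pT; apply: cT; left.
- move=> w [|T l] _ lp; first exact: rank_sub (rT w).
  by case: lp => [].
have [sA NE incr steps] := lA.
have [T [//|[i _ iT]]|l lst|x xP] := @saturation L K C Csat n N (stage set0 H setT g) (ladder_sm hK sI lA).
- have [j [ij _]] := ladder_next Ine Ibound i i.
  have [o _ _] := gZ i; apply: dfn_sub (o j ij T iT); exact: ladder_le lA.
- exact: rank_ex (gst [::] l I lst).
pose c := [tuple x i | i < n].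
have cx : tnth c = x by exact: tnth_mktupleE.
have Sc : S_star P N (tp c N).
  apply: comp_S_star => D dD [z Pz Dz].
  have [|x' x'N Dx'] := @asked_code L C n 0 e0 N (tnth c) D.
    apply: dfn_sub dD => d [Nd|xd]; last by right.
    by left; left.
  have [i x'A] : exists i, cpar x' `<=` A i.
    exact: (ladder_code Ine Ibound lA x'N).
  have [_ /(_ (ex_intro _ z Pz) x' x'A)[d [Pd Nd] gd] _] := gZ i.
  exists d => //; rewrite Dx' cx.
  have := xP _ (or_intror (ex_intro2 _ _ i I gd)); apply.
  by exists z => //; rewrite -cx -Dx'.
(* The code is a family indexed by [F], hence bounded in the chain; stage [i] has excluded this
   type. *)
have [i ri] : exists i, range (e (tp c N)) `<=` A i.
  have hP f : exists i, A i (e (tp c N) f).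
    have : N (e (tp c N) f) by apply: (eN _ Sc); exists f.
    by rewrite {1}NE => -[i _]; exists i.
  have [h hA] := choice hP; have [i iP] := Ibound h.
  by exists i => _ [f _ <-]; exact: incr (iP f) _ (hA f).
have [_ _ /(_ c Sc ri)] := gZ i; apply=> T gT; rewrite cx; apply: xP; right.
by exists i.
Qed.
End Counting.

(** * Definability of types *)

Section Definability.
Variables (L : language) (P : rel_sym L) (C : structure L).
Local Notation PC := (Pset P C).
Local Notation dfn := (@dfn L C _).
Variables (n k : nat) (ph : ('I_n -> C) -> ('I_k -> C) -> Prop).
Local Notation vec := ('I_n -> C).
Hypothesis dph : dfn set0 (fun g : 'I_n + 'I_k -> C => ph (g \o inl) (g \o inr)).

Lemma dfn_question_param (B : set C) (q : question C n) (nu : 'I_(q_size q) -> C) :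
  range nu `<=` B ->
  dfn B (fun g : option 'I_n -> C => q_body q (g None) (g \o some) nu).
Proof.
move=> nuB.
pose s (v : option ('I_n + 'I_(q_size q))) : option 'I_n + C := match v with
  None => inl None | Some (inl i) => inl (Some i) | Some (inr j) => inr (nu j) end.
have sB v c : s v = inr c -> B c.
  by case: v => [[i|j]|] //= [<-]; apply: nuB; exists j.
exact: dfn_ext (dfn_subst sB (dfn_sub (@sub0set _ B) (q_dfn q))).
Qed.

(** Some suffix [o :: v] of [w] has the property that all sets in the type of [c] have rank [v], but
    some [T] fails [o :: v]. Here [o] is no question: completeness supplies an answer in [N], and
    the answer condition belongs to the type. So [T] cannot be split at rank [v], and an instance of
    [ph] is in the type exactly if it keeps rank [v] inside [T]. *)
Lemma definable_type_of (N : set C) (c : vec) w : TV N ->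
  comp P N (N `|` range c) -> ~ rank P ph w (fun=> True) ->
  exists2 alpha : ('I_k -> C) -> Prop, dfn N alpha &
    forall m, range m `<=` N -> (ph c m <-> alpha m).
Proof.
move=> tv cN nw.
pose large v := forall T : vec -> Prop, dfn N T -> T c -> rank P ph v T.
have [v [o [lv nlv]]] : exists v o, large v /\ ~ large (o :: v).
  have : ~ large w by move=> /(_ (fun=> True) (dfn_true _ _)) /(_ Logic.I).
  elim: w {nw} => [|o w IH] nl; first by case: nl => T _ Tc; exists c.
  by have [lw|nlw] := pselect (large w); [exists w, o | exact: IH].
case: o nlv => [q|] nlv.
  case: nlv => T dT Tc; split=> [|Pne nu]; first exact: lv.
  pose X (nu : 'I_(q_size q) -> C) := exists d, PC d /\
    rank P ph v (fun x => T x /\ answer P (fun z x => q_body q z x nu) d x).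
  suff [d [Pd rd]] : X nu by exists d.
  apply: contrapT => nX.
  have dX : dfn N (fun nu => ~ X nu).
    apply: dfn_not; apply: (dfn_ex (D := fun d nu => PC d /\
      rank P ph v (fun x => T x /\ answer P (fun z x => q_body q z x nu) d x))).
    apply: dfn_and; first exact: dfn_P.
    apply: (@dfn_rank L P C n k ph dph _ _ _ (fun x g => T x /\
      answer P (fun z x => q_body q z x (g \o some)) (g None) x)).
    apply: dfn_and; first exact: (dfn_var inl dT).
    exact: (@dfn_answer_question _ P _ _ (option 'I_(q_size q)) N q None some).
  have [|nu' nu'N nX'] := tv _ _ dX; first by exists nu.
  pose A d := answer P (fun z x => q_body q z x nu') d c.
  have [||d [Pd Nd] Ad] := cN A.
  - exact: (dfn_glue (dfn_answer P tt (dfn_question_param nu'N)) (@subsetUl _ _ _) (@subsetUr _ _ _)).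
  - have [[z Pz qz]|nz] := pselect (exists2 z, PC z & q_body q z c nu').
      by exists z.
    by case: Pne => p Pp; exists p => // z; case: nz.
  apply: nX'; exists d; split=> //; apply: lv => //.
  apply: dfn_and => //; apply: dfn_answer_param => //; exact: dfn_question_param.
have [T [dT Tc nT]] : exists T, [/\ dfn N T, T c & ~ rank P ph (None :: v) T].
  apply: contrapT => nT; apply: nlv => T dT Tc; apply: contrapT => nr; apply: nT.
  by exists T.
exists (fun m => rank P ph v (fun x => T x /\ ph x m)).
  apply: (@dfn_rank L P C n k ph dph _ _ _ (fun x g => T x /\ ph x g)).
  by apply: dfn_and (dfn_sub (@sub0set _ _) dph); exact: (dfn_var inl dT).
move=> m mN; have dm := dfn_instance dph mN.
split=> [cm|r1]; first by apply: lv => //; exact: dfn_and.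
apply: contrapT => ncm; apply: nT; exists m; split=> //.
by apply: lv => //; apply: dfn_and => //; exact: dfn_not.
Qed.
End Definability.

(** * Lengthening tuples within [S_*(N)] *)

Section Extension.
Variables (L : language) (P : rel_sym L) (K : Type) (C : structure L).
Local Notation PC := (Pset P C).
Local Notation dfn := (@dfn L C _).
Local Notation F := {n & formula L n}.

Definition definable (N : set C) r (c : 'I_r -> C) :=
  forall k (psi : formula L (r + k)), exists2 alpha : ('I_k -> C) -> Prop,
    dfn N alpha & forall h, range h `<=` N -> (fsat psi (fcat c h) <-> alpha h).

Lemma dfn_sum_nf (B : set C) r k (E : ('I_r + 'I_k -> C) -> Prop) : dfn B E ->
  exists s (w : 'I_s -> C) (psi : formula L (r + (k + s))), range w `<=` B /\
    forall y h, E (fsum y h) <-> fsat psi (fcat y (fcat h w)).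
Proof.
move=> /dfn_nf[l [u [s [w [phi [wB Ephi]]]]]].
pose t (i : 'I_(l + s)) : 'I_(r + (k + s)) := match fintype.split i with
  | inl a => match u a with inl b => lshift _ b | inr b => rshift r (lshift s b) end
  | inr b => rshift r (rshift k b) end.
exists s, w, (rename phi t); split=> // y h; rewrite Ephi fsat_rename.
suff -> : fcat (fsum y h \o u) w = fcat y (fcat h w) \o t by [].
apply: funext => i; rewrite /= /t {1}/fcat; case: fintype.split => a /=.
  by case: (u a) => b; rewrite ?fcat_rshift fcat_lshift.
by rewrite !fcat_rshift.
Qed.

Lemma dfn_fcat_param V (B : set C) k s (w : 'I_s -> C) (alpha : ('I_(k + s) -> C) -> Prop)
    (u : 'I_k -> V) : range w `<=` B -> dfn B alpha ->
  dfn B (fun g : V -> C => alpha (fcat (g \o u) w)).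
Proof.
move=> wB da; pose t (i : 'I_(k + s)) : V + C := match fintype.split i with
  inl a => inl (u a) | inr b => inr (w b) end.
have tB i c : t i = inr c -> B c.
  by rewrite /t; case: fintype.split => // j [<-]; apply: wB; exists j.
apply: dfn_ext (dfn_subst tB da) => g.
suff -> : fsum g id \o t = fcat (g \o u) w by [].
by apply: funext => i; rewrite /= /t /fcat; case: fintype.split.
Qed.

Lemma range_fcat (U : Type) k s (h : 'I_k -> U) (w : 'I_s -> U) (B : set U) :
  range h `<=` B -> range w `<=` B -> range (fcat h w) `<=` B.
Proof.
move=> hB wB _ [i _ <-]; rewrite /fcat; case: fintype.split => j.
  by apply: hB; exists j.
by apply: wB; exists j.
Qed.

Hypothesis hK : strongly_inaccessible K.
Hypothesis sF : sm K [set: F].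
Hypothesis Csat : saturated K C.
Hypothesis H2 : hypothesis_H2 P C.
Variables (J : Type) (lt : J -> J -> Prop).
Hypothesis wo : strict_wo lt.
Hypothesis sI : sm K [set: J].
Hypothesis Ine : exists i : J, True.
Hypothesis Ibound : forall h : F -> J, exists i, forall f, lt (h f) i.
Local Notation ladder := (ladder K lt).

(** The definitions form a family indexed by [F], so one set of the chain contains the parameters of
    all of them. *)
Lemma ladder_scheme N A r (e : 'I_r -> C) : ladder N A -> definable N e ->
  exists i1, forall k (psi : formula L (r + k)), exists2 alpha : ('I_k -> C) -> Prop,
    dfn (A i1) alpha & forall h, range h `<=` N -> (fsat psi (fcat e h) <-> alpha h).
Proof.
move=> lA de; have [i0 _] := Ine; have [_ _ incr _] := lA.
have hP (f : F) : exists i, forall k (psi : formula L (r + k)), f = existT _ (r + k) psi ->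
    exists2 alpha : ('I_k -> C) -> Prop, dfn (A i) alpha &
      forall h, range h `<=` N -> (fsat psi (fcat e h) <-> alpha h).
  have [[k [psi ->]]|nf] := pselect (exists k (psi : formula L (r + k)), f = existT _ (r + k) psi).
    have [alpha da aP] := de k psi; have [i di] := ladder_dfn Ine Ibound lA da.
    exists i => k' psi' E; have /addnI kk : r + k = r + k' := f_equal (@projT1 _ _) E.
    subst k'; exists alpha => // h hN.
    by rewrite -(inj_pair2_eq_dec nat (@eq_comparable nat) (formula L) _ _ _ E); exact: aP.
  by exists i0 => k psi E; case: nf; exists k, psi.
have [h hA] := choice hP; have [i iP] := Ibound h; exists i => k psi.
have [alpha da aP] := hA _ k psi erefl; exists alpha => //.
exact: dfn_sub (incr _ _ (iP _)) da.
Qed.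

(** Completeness gives the trace a defining parameter in [N], but one in [S] is needed. That [d]
    defines the trace is a formula about [e]; the scheme of [e] turns it into a condition on [d]
    over [A i], which is realized in [S]. *)
Lemma ladder_traced N A r (e : 'I_r -> C) : ladder N A ->
  comp P N (N `|` range e) -> definable N e ->
  exists i1, forall i S, lt i1 i -> rich (A i) S -> S `<=` N -> traced P S (A i `|` range e).
Proof.
move=> lA ce de; have [i1 i1P] := ladder_scheme lA de; have [_ _ incr _] := lA.
exists i1 => i S i1i rS SN; apply: traced_fin => l D dD.
have [r' [E [dE [d dP DE]]]] := trace_formula H2 dD.
have dX := dfn_agreeP P dD (dfn_sub (@sub0set _ _) dE).
have AN : A i `<=` N := ladder_le lA.
have [||d2 d2N Xd2] := compv (@subsetUl _ _ _) ce (D := fun d => forall h,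
    (forall i, PC (h i)) -> (D h <-> E (fsum d h))) _ (ex_intro2 _ _ d dP _).
- by apply: dfn_sub dX => c [/AN|]; [left | right].
- by move=> h hP; apply: DE => _ [j _ <-].
have [X1 dX1 XX1] := dfn_sep dX.
have [s [w [psi [wA X1psi]]]] := dfn_sum_nf dX1.
have [alpha da aP] := i1P _ psi.
have XE d' : range d' `<=` N -> (forall h, (forall i, PC (h i)) -> (D h <-> E (fsum d' h))) <->
    alpha (fcat d' w).
  move=> d'N; rewrite XX1 X1psi aP //; apply: range_fcat => //.
  exact: subset_trans wA AN.
have dQ : dfn (A i) (fun d' => (forall j, PC (d' j)) /\ alpha (fcat d' w)).
  apply: dfn_and; first exact: dfn_allP.
  exact: (dfn_fcat_param id wA (dfn_sub (incr _ _ i1i) da)).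
have [|d' d'S [d'P ad']] := rich_point rS dQ.
  exists d2; split; first by move=> j; case: (d2N (d2 j)) => //; exists j.
  by apply/XE => // c /d2N[].
exists (fun h => E (fsum d' h)).
  exact: (dfn_glue dE).
have [_ XEd] := XE d' (subset_trans d'S SN).
by move=> h hP; apply: (XEd ad') => j; apply: hP; exists j.
Qed.

(** A single point of [T] can always be kept: answer each question by a solution at that point, or
    arbitrarily if there is none. *)
Lemma rank_questions n k (ph : ('I_n -> C) -> ('I_k -> C) -> Prop) w (T : ('I_n -> C) -> Prop) :
  all_of (fun o : option (question C n) => isSome o) w -> (exists x, T x) -> rank P ph w T.
Proof.
elim: w T => [|[q|] w IH] T /=; [by [] | move=> [_ wq] [x Tx] | by case].
split; first by apply: IH => //; exists x.
move=> [p Pp] nu.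
have [[z Pz qz]|nz] := pselect (exists2 z, PC z & q_body q z x nu).
  by exists z => //; apply: (IH _ wq); exists x; split.
by exists p => //; apply: (IH _ wq); exists x; split=> // qx; case: nz.
Qed.

(** The chain construction without splittings: [ph] is false and the words contain questions only,
    so infinite rank of [rho] amounts to its consistency. *)
Lemma special_extend N r (e : 'I_r -> C) j (rho : ('I_j -> C) -> Prop) :
  special K lt N -> comp P N (N `|` range e) -> definable N e ->
  dfn (N `|` range e) rho -> (exists nu, rho nu) ->
  exists2 nu, rho nu & comp P N (N `|` range (fcat e nu)).
Proof.
move=> [A lA] ce de drho [nu0 rnu0].
have [sA NE incr steps] := lA.
have [i1 i1P] := ladder_traced lA ce de.
have [i2 drho2] : exists i, dfn (A i `|` range e) rho.
  have [E dE rE] := dfn_sep drho; have [i di] := ladder_dfn Ine Ibound lA dE.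
  exists i; apply: dfn_ext (dfn_glue di (@subsetUl _ _ _) (@subsetUr _ _ _)) => g.
  by rewrite rE.
have [i3 [i13 i23]] := ladder_next Ine Ibound i1 i2.
pose ph (x : 'I_j -> C) (m : 'I_0 -> C) := False.
have dph : dfn set0 (fun g : 'I_j + 'I_0 -> C => ph (g \o inl) (g \o inr)) by exact: dfn_false.
pose W : set (seq (option (question C j))) := [set w | all_of (fun o => isSome o) w].
have Wcat u w : W u -> W w -> W (u ++ w) by move=> Wu Ww; apply/all_of_cat.
have Wask q w : W w -> W (Some q :: w) by [].
pose Z (i : J) (st y : set (('I_j -> C) -> Prop)) :=
  (forall i', lt i3 i' -> lt i i' -> over (A i' `|` range e) y) /\
  (lt i3 i -> (exists p, PC p) -> forall x : code C nat, cpar x `<=` A i ->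
    exists2 d, PC d /\ N d & y (answer P (asked e x) d)).
pose H (i : J) (y : set (('I_j -> C) -> Prop)) := y.
have [i g gst gZ||g [gst gZ]] := good_recursion wo (pi := [set rho]) (H := H) set0
    (Z := Z) (W := W) (ph := ph) (P := P).
- have [Pne|Pe] := pselect (exists p, PC p); last first.
    exists set0; split; first by rewrite /H setU0.
    by split=> [i' _ _ T []|_ /Pe].
  have [i3i|ni3i] := pselect (lt i3 i); last first.
    exists set0; split; first by rewrite /H setU0.
    by split=> [i' _ _ T []|/ni3i].
  have [S [S' [rS rS' S'A]]] := steps i.
  have [i' [ii' _]] := ladder_next Ine Ibound i i.
  have S'N : S' `<=` N := subset_trans (S'A i' ii') (ladder_le lA).
  have [AS _ _] := rS; have [SS' _ _] := rS'.
  have tr : traced P S (A i `|` range e).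
    apply: i1P => //; [exact: swo_trans i3i | exact: subset_trans S'N].
  have ost : over (A i `|` range e) (stage [set rho] H [set u | lt u i] g).
    move=> T [->|[u ui uT]].
      apply: dfn_sub drho2; apply: setSU; apply: incr; exact: swo_trans i3i.
    by have [o _] := gZ u ui; exact: o uT.
  have sB : sm K (A i `|` range e) by apply: (sm_setU hK) => //; exact: (sm_range_ord hK).
  have [d dP gd] := good_answers hK sF Csat dph (W := W) Logic.I Wcat Wask (e := e)
    (sA i) sB AS rS' (@subsetUl _ _ _) (@subsetUr _ _ _) tr Pne ost gst.
  exists [set T | exists2 x, cpar x `<=` A i & T = answer P (asked e x) (d x)].
  split=> //; split=> [i4 i34 ii4 T [x xA ->]|_ _ x xA].
    apply: dfn_answer_param; first by left; apply: (S'A i4 ii4); case: (dP x xA).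
    apply: dfn_asked => [c /xA Ac|c ec]; [left; exact: incr ii4 _ Ac | by right].
  have [Pd Sd] := dP x xA; exists (d x); last by exists x.
  by split=> //; exact: S'N.
- move=> w l Ww lp; apply: rank_questions => //; exists nu0.
  by apply: all_of_sub lp => T ->.
have sN := ladder_sm hK sI lA.
have [||l lst|x xP] := @saturation L K C Csat j (N `|` range e) (stage [set rho] H setT g).
- by apply: (sm_setU hK) => //; exact: (sm_range_ord hK).
- move=> T [->//|[i _ iT]]; have [i' [ii' i3i']] := ladder_next Ine Ibound i i3.
  have [o _] := gZ i; apply: dfn_sub (o i' i3i' ii' T iT); apply: setSU; exact: ladder_le lA.
- exact: rank_ex (gst [::] l Logic.I lst).
exists x; first by apply: xP; left.
move=> D dD [z Pz Dz].
have [|x' x'N Dx'] := @asked_code L C j r e N x D.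
  apply: dfn_sub dD => c [Nc|]; first by left; left.
  move=> [i _ <-]; rewrite /fcat; case: fintype.split => i'; last by right; exists i'.
  by left; right; exists i'.
have [i x'A] := ladder_code Ine Ibound lA x'N.
have [i' [ii' i3i']] := ladder_next Ine Ibound i i3.
have [|d [Pd Nd] gd] := (gZ i').2 i3i' (ex_intro _ z Pz) x'.
  exact: subset_trans (incr _ _ ii').
exists d => //; apply/Dx'; have : answer P (asked e x') d x.
  by apply: xP; right; exists i'.
by apply; exists z => //; apply/Dx'.
Qed.
End Extension.

(** * Heirs *)

Section Heirs.
Variables (L : language) (P : rel_sym L) (K : Type) (C : structure L).
Local Notation PC := (Pset P C).
Local Notation dfn := (@dfn L C _).

Definition dfn2 V W (B : set C) (E : (V -> C) -> (W -> C) -> Prop) :=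
  dfn B (fun g : V + W -> C => E (g \o inl) (g \o inr)).

Lemma dfn2_sub V W (B B' : set C) (E : (V -> C) -> (W -> C) -> Prop) :
  B `<=` B' -> dfn2 B E -> dfn2 B' E.
Proof. exact: dfn_sub. Qed.

Lemma dfn2_swap V W (B : set C) (E : (V -> C) -> (W -> C) -> Prop) :
  dfn2 B E -> dfn2 B (fun h y => E y h).
Proof. exact: (dfn_var (fun x : V + W => match x with inl v => inr v | inr w => inl w end)). Qed.

Lemma dfn2_left V W (B : set C) (E : (V -> C) -> (W -> C) -> Prop) c :
  dfn2 B E -> range c `<=` B -> dfn B (E c).
Proof. by move=> dE cB; exact: (dfn_glue dE (@subset_refl _ B) cB). Qed.

Lemma dfn2_right V W (B : set C) (E : (V -> C) -> (W -> C) -> Prop) h :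
  dfn2 B E -> range h `<=` B -> dfn B (E^~ h).
Proof. by move=> /dfn2_swap dE hB; exact: (dfn2_left dE hB). Qed.

Lemma dfn2_fsat r k (psi : formula L (r + k)) (B : set C) :
  dfn2 B (fun y h => fsat psi (fcat y h)).
Proof.
pose s (i : 'I_(r + k)) : 'I_r + 'I_k := fintype.split i.
apply: dfn_ext (@dfn_fsat L C _ B _ psi s) => g.
suff -> : g \o s = fcat (g \o inl) (g \o inr) by [].
by apply: funext => i; rewrite /= /s /fcat; case: fintype.split.
Qed.

Lemma dfn2_nf (B : set C) r k (E : ('I_r -> C) -> ('I_k -> C) -> Prop) : dfn2 B E ->
  exists s (w : 'I_s -> C) (psi : formula L (r + (k + s))), range w `<=` B /\
    forall y h, E y h <-> fsat psi (fcat y (fcat h w)).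
Proof.
move=> /dfn_sum_nf[s [w [psi [wB Epsi]]]]; by exists s, w, psi.
Qed.

Lemma TV_all (M : set C) k (D : ('I_k -> C) -> Prop) : TV M -> dfn M D ->
  (forall h, range h `<=` M -> D h) -> forall h, D h.
Proof.
move=> tv dD DM h; apply: contrapT => nD.
have [|h' h'M] := tv _ _ (dfn_not dD); first by exists h.
by apply; exact: DM.
Qed.

Lemma dfn_unique (M : set C) k (D D' : ('I_k -> C) -> Prop) : TV M -> dfn M D -> dfn M D' ->
  (forall h, range h `<=` M -> (D h <-> D' h)) -> forall h, D h <-> D' h.
Proof. by move=> tv dD dD'; apply: TV_all => //; exact: dfn_iff. Qed.

Lemma TV_comp (N : set C) : TV N -> comp P N N.
Proof.
move=> tv D dD [z Pz Dz].
have dD' : dfn N (fun h : 'I_1 -> C => PC (h ord0) /\ D (h ord0)).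
  apply: dfn_and; first exact: dfn_P.
  exact: (dfn_var (fun=> ord0) dD).
have [|h hN [Ph Dh]] := tv _ _ dD'; first by exists (fun=> z).
by exists (h ord0) => //; split=> //; apply: hN; exists ord0.
Qed.

Lemma definableE (N : set C) r (c : 'I_r -> C) k (E : ('I_r -> C) -> ('I_k -> C) -> Prop) :
  definable N c -> dfn2 N E ->
  exists2 alpha : ('I_k -> C) -> Prop, dfn N alpha &
    forall h, range h `<=` N -> (E c h <-> alpha h).
Proof.
move=> dc /dfn2_nf[s [w [psi [wN Epsi]]]]; have [alpha da aP] := dc _ psi.
exists (fun h => alpha (fcat h w)); first exact: (dfn_fcat_param id wN da).
by move=> h hN; rewrite Epsi aP //; exact: range_fcat.
Qed.

(* The tuple [c'] realizes over [A] the type given by the definition scheme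
   of the type of [c] over the model [M]. *)
Definition ext (M : set C) r (c : 'I_r -> C) (A : set C) (c' : 'I_r -> C) :=
  forall k (E : ('I_r -> C) -> ('I_k -> C) -> Prop) (alpha : ('I_k -> C) -> Prop),
    dfn2 M E -> dfn M alpha -> (forall h, range h `<=` M -> (E c h <-> alpha h)) ->
    forall h, range h `<=` A -> (E c' h <-> alpha h).

Lemma ext_sub (M : set C) r (c : 'I_r -> C) A A' c' : A `<=` A' ->
  ext M c A' c' -> ext M c A c'.
Proof. move=> AA' e k E alpha dE da aP h hA; apply: e dE da aP _ _; exact: subset_trans AA'. Qed.

Lemma ext_formulas (M : set C) r (c : 'I_r -> C) A c' : TV M -> M `<=` A ->
  (forall k (psi : formula L (r + k)), exists2 alpha : ('I_k -> C) -> Prop, dfn M alpha &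
     (forall h, range h `<=` M -> (fsat psi (fcat c h) <-> alpha h)) /\
     (forall h, range h `<=` A -> (fsat psi (fcat c' h) <-> alpha h))) ->
  ext M c A c'.
Proof.
move=> tv MA H k E alpha /dfn2_nf[s [w [psi [wM Epsi]]]] da aP h hA.
have [beta db [b1 b2]] := H _ psi.
have wA : range w `<=` A := subset_trans wM MA.
rewrite Epsi b2; last exact: range_fcat.
suff e : forall h, beta (fcat h w) <-> alpha h by exact: e.
apply: (dfn_unique tv) => // [|h' h'M]; first exact: (dfn_fcat_param id wM db).
by rewrite -aP // Epsi b1 //; exact: range_fcat.
Qed.

Lemma ext_agree (M : set C) r (c : 'I_r -> C) A c1 A' c2 N (T : ('I_r -> C) -> Prop) :
  definable M c -> ext M c A c1 -> ext M c A' c2 -> N `<=` A -> N `<=` A' ->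
  dfn N T -> (T c1 <-> T c2).
Proof.
move=> dc e1 e2 NA NA' /dfn_params[s [E0 [dE0 [w wN TE]]]].
pose E y h := E0 (fsum h y).
have dE : dfn2 set0 E.
  apply: dfn_ext (dfn_var (fun x : 'I_s + 'I_r => match x with
    inl i => inr i | inr i => inl i end) dE0) => g; rewrite /E.
  set g1 := (X in E0 X <-> _); set g2 := (X in _ <-> E0 X).
  by suff -> : g1 = g2 by []; apply: funext => -[].
have dEM : dfn2 M E := dfn2_sub (@sub0set _ _) dE.
have [alpha da aP] := definableE dc dEM.
rewrite !TE -/(E c1 w) -/(E c2 w) (e1 _ _ _ dEM da aP) ?(e2 _ _ _ dEM da aP) //.
  exact: subset_trans NA'.
exact: subset_trans NA.
Qed.

Lemma ext_refl (M : set C) r (c : 'I_r -> C) : ext M c M c.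
Proof. by move=> k E alpha dE da aP h hM; exact: aP. Qed.

Lemma ext_type (M : set C) r (c : 'I_r -> C) A c' (T : ('I_r -> C) -> Prop) :
  definable M c -> ext M c A c' -> M `<=` A -> dfn M T -> (T c <-> T c').
Proof. by move=> dc e MA; exact: (ext_agree dc (@ext_refl M r c) e). Qed.

Lemma ext_tower (M : set C) r (c : 'I_r -> C) N A c' : definable M c -> ext M c A c' ->
  M `<=` N -> N `<=` A -> TV N -> definable N c' /\ ext N c' A c'.
Proof.
move=> dc e MN NA tv.
have H k (psi : formula L (r + k)) : exists2 alpha : ('I_k -> C) -> Prop, dfn M alpha &
    forall h, range h `<=` A -> (fsat psi (fcat c' h) <-> alpha h).
  have [alpha da aP] := dc k psi; exists alpha => // h hA.
  exact: (e _ _ _ (dfn2_fsat psi M) da aP).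
split=> [k psi|].
  have [alpha da aP] := H k psi; exists alpha; first exact: dfn_sub da.
  by move=> h hN; apply: aP; exact: subset_trans NA.
apply: ext_formulas => // k psi; have [alpha da aP] := H k psi.
exists alpha; first exact: dfn_sub da.
by split=> // h hN; apply: aP; exact: subset_trans NA.
Qed.

Lemma ext_inside (N : set C) r (c : 'I_r -> C) A : TV N -> N `<=` A -> range c `<=` N ->
  definable N c /\ ext N c A c.
Proof.
move=> tv NA cN; have H k (psi : formula L (r + k)) : dfn N (fun h => fsat psi (fcat c h)).
  exact: dfn2_left (dfn2_fsat psi N) cN.
split=> [k psi|]; first by exists (fun h => fsat psi (fcat c h)).
by apply: ext_formulas => // k psi; exists (fun h => fsat psi (fcat c h)).
Qed.

(** The scheme of [e0] eliminates [e] first, with [b] among its parameters, and the scheme of [b]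
    then eliminates [b]. This order works because [e] is independent over a set containing [b]. *)
Lemma ext_pair (N : set C) r s (e0 e : 'I_r -> C) (b : 'I_s -> C) A A' : TV N ->
  N `<=` A -> A `<=` A' -> range b `<=` A' -> definable N b -> ext N b A b ->
  definable N e0 -> ext N e0 A' e ->
  definable N (fcat e b) /\ ext N (fcat e b) A (fcat e b).
Proof.
move=> tv NA AA' bA' db eb de ee.
have H k (psi : formula L (r + s + k)) : exists2 alpha : ('I_k -> C) -> Prop, dfn N alpha &
    forall h, range h `<=` A -> (fsat psi (fcat (fcat e b) h) <-> alpha h).
  pose E1 (y : 'I_r -> C) (g : 'I_(s + k) -> C) : Prop :=
    fsat psi (fcat (fcat y (fun i => g (lshift k i))) (fun i => g (rshift s i))).
  have dE1 : dfn2 N E1.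
    pose t (i : 'I_(r + s + k)) : 'I_r + 'I_(s + k) := match fintype.split i with
      | inl a => match fintype.split a with inl a' => inl a' | inr b => inr (lshift k b) end
      | inr b => inr (rshift s b) end.
    apply: dfn_ext (@dfn_fsat L C _ N _ psi t) => g; rewrite /E1.
    set g1 := (X in fsat psi X <-> _); set g2 := (X in _ <-> fsat psi X).
    suff -> : g1 = g2 by []; apply: funext => i; rewrite /g1 /g2 /= /t /fcat.
    by case: fintype.split => // a; case: fintype.split.
  have [alpha1 da1 a1P] := definableE de dE1.
  have dE2 : dfn2 N (fun (y : 'I_s -> C) (h : 'I_k -> C) => alpha1 (fcat y h)).
    pose t (i : 'I_(s + k)) : 'I_s + 'I_k := fintype.split i.
    apply: dfn_ext (dfn_var t da1) => g.
    suff -> : g \o t = fcat (g \o inl) (g \o inr) by [].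
    by apply: funext => i; rewrite /= /t /fcat; case: fintype.split.
  have [alpha2 da2 a2P] := definableE db dE2.
  exists alpha2 => // h hA; rewrite -(eb _ _ _ dE2 da2 a2P) //.
  rewrite -(ee _ _ _ dE1 da1 a1P); last by apply: range_fcat => //; exact: subset_trans AA'.
  rewrite /E1.
  have -> : (fun i => fcat b h (lshift k i)) = b by apply: funext => i; rewrite fcat_lshift.
  by have -> : (fun i => fcat b h (rshift s i)) = h by apply: funext => i; rewrite fcat_rshift.
split=> [k psi|].
  have [alpha da aP] := H k psi; exists alpha => // h hN; apply: aP; exact: subset_trans NA.
apply: ext_formulas => // k psi; have [alpha da aP] := H k psi.
by exists alpha => //; split=> // h hN; apply: aP; exact: subset_trans NA.
Qed.

Lemma ext_proj (N : set C) r s (c c' : 'I_(r + s) -> C) A : ext N c A c' ->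
  ext N (fun i => c (lshift s i)) A (fun i => c' (lshift s i)).
Proof.
move=> e k E alpha dE da aP.
apply: (e _ (fun y h => E (fun i => y (lshift s i)) h)) => //.
exact: (dfn_var (fun x : 'I_r + 'I_k => match x with
  inl i => inl (lshift s i) | inr j => inr j end) dE).
Qed.

Lemma ext_subtuple (M : set C) r k (b : 'I_r -> C) (h : 'I_k -> C) A :
  range h `<=` M `|` range b -> ext M b A b -> ext M h A h.
Proof.
move=> hb e l E alpha dE da aP.
have sP j : exists y : 'I_r + C, (forall d, y = inr d -> M d) /\ h j = fsum b id y.
  have [Mh|[i _ <-]] : (M `|` range b) (h j) by apply: hb; exists j.
    by exists (inr (h j)); split=> // d [<-].
  by exists (inl i).
have [s sP'] := choice sP.
have hE : h = (fun j => fsum b id (s j)) by apply: funext => j; exact: (sP' j).2.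
rewrite hE in aP *.
apply: (e _ (fun y g => E (fun j => fsum y id (s j)) g)) => //.
pose t (x : 'I_k + 'I_l) : ('I_r + 'I_l) + C := match x with
  inl j => match s j with inl i => inl (inl i) | inr d => inr d end | inr j => inl (inr j) end.
have tB x d : t x = inr d -> M d.
  rewrite /t; case: x => // j; case Es: (s j) => // [d'] [<-]; exact: (sP' j).1.
apply: dfn_ext (dfn_subst tB dE) => g.
suff -> : (fsum g id \o t) \o inl = (fun j => fsum (g \o inl) id (s j)) by [].
by apply: funext => j; rewrite /= /t; case: (s j).
Qed.

(** Solvability in [P] is turned by the scheme of [c] into a condition on parameters in [G], where
    completeness of [G] gives a solution in [N]; the scheme turns it back into a solution for
    [c']. *)
Lemma ext_comp (M : set C) r (c : 'I_r -> C) A c' G N : definable M c ->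
  comp P M (M `|` range c) -> TV M -> ext M c A c' -> M `<=` G -> G `<=` A -> N `<=` A ->
  comp P N G -> comp P N (G `|` range c').
Proof.
move=> dc cc tv e MG GA NA cG D /dfn_sep[D1 dD1 DD1] [z Pz Dz].
have [s [E0 [dE0 [nu nuG D1E]]]] := dfn_params dD1.
pose E (y : 'I_r -> C) (h : 'I_s.+1 -> C) : Prop :=
  E0 (fsum (h \o lift ord0) (fsum y (fun _ : unit => h ord0))).
have DE x : D x <-> E c' (fcons x nu).
  rewrite (DD1 (fun=> x)) D1E /E fcons0.
  suff -> : fcons x nu \o lift ord0 = nu by [].
  by apply: funext => i; rewrite /= fconsS.
have dE : dfn2 M E.
  apply: dfn_ext (dfn_var (fun v : 'I_s + ('I_r + unit) => match v with
    inl i => inr (lift ord0 i) | inr (inl i) => inl i | inr (inr _) => inr ord0 end)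
    (dfn_sub (@sub0set _ _) dE0)) => g; rewrite /E.
  set g1 := (X in E0 X <-> _); set g2 := (X in _ <-> E0 X).
  by suff -> : g1 = g2 by []; apply: funext => -[|[]].
pose X (y : 'I_r -> C) (g : 'I_s -> C) := exists z, PC z /\ E y (fcons z g).
have dX : dfn2 M X.
  apply: (dfn_ex (D := fun z g => PC z /\ E (g \o inl) (fcons z (g \o inr)))).
  apply: dfn_and; first exact: dfn_P.
  pose t (v : 'I_r + 'I_s.+1) : option ('I_r + 'I_s) := match v with
    inl i => Some (inl i) | inr j => omap inr (unlift ord0 j) end.
  apply: dfn_ext (dfn_var t dE) => g.
  suff -> : (g \o t) \o inr = fcons (g None) ((g \o some) \o inr) by [].
  by apply: funext => j; rewrite /= /t /fcons; case: unlift.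
have [aE daE aEP] := definableE dc dE; have [aX daX aXP] := definableE dc dX.
(* For parameters in [M] this is completeness of [M] with [c]; being first-order over the model [M],
   it holds for all parameters. *)
have aXE g : aX g -> exists z, PC z /\ aE (fcons z g).
  move: g; apply: (TV_all tv (D := fun g => aX g -> exists z, PC z /\ aE (fcons z g))).
    apply: dfn_imp => //; apply: (dfn_ex (D := fun z g => PC z /\ aE (fcons z g))).
    apply: dfn_and; first exact: dfn_P.
    pose t (j : 'I_s.+1) : option 'I_s := unlift ord0 j.
    apply: dfn_ext (dfn_var t daE) => g.
    suff -> : g \o t = fcons (g None) (g \o some) by [].
    by apply: funext => j; rewrite /= /t /fcons; case: unlift.
  move=> g gM /(aXP g gM)[x [Px Ex]].
  have [||y [Py My] Ey] := cc (fun z => E c (fcons z g)); last first.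
  - by exists y; split=> //; apply/aEP => //; exact: range_fcons.
  - by exists x.
  pose t (v : 'I_r + 'I_s.+1) : unit + C := match v with
    inl i => inr (c i) | inr j => oapp (fun j => inr (g j)) (inl tt) (unlift ord0 j) end.
  have tB v d : t v = inr d -> (M `|` range c) d.
    case: v => [i|j] /=; first by case=> <-; right; exists i.
    by case: unlift => //= j' [<-]; left; apply: gM; exists j'.
  apply: dfn_ext (dfn_subst tB (dfn_sub (@subsetUl _ _ _) dE)) => f.
  suff -> : (fsum f id \o t) \o inr = fcons (f tt) g by [].
  by apply: funext => j; rewrite /= /t /fcons; case: unlift.
have nuA : range nu `<=` A := subset_trans nuG GA.
have [x [Px Ex]] : exists z, PC z /\ aE (fcons z nu).
  by apply: aXE; apply/(e _ _ _ dX daX aXP nu nuA); exists z; split=> //; apply/DE.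
have eqE y : A y -> E c' (fcons y nu) <-> aE (fcons y nu).
  by move=> Ay; apply: (e _ _ _ dE daE aEP); exact: range_fcons.
have [||y [Py Ny] Ey] := cG (fun z => aE (fcons z nu)); last first.
- by exists y => //; apply/DE/eqE => //; exact: NA.
- by exists x.
pose t (j : 'I_s.+1) : unit + C := oapp (fun j => inr (nu j)) (inl tt) (unlift ord0 j).
have tB v d : t v = inr d -> G d.
  by rewrite /t; case: unlift => //= j' [<-]; apply: nuG; exists j'.
apply: dfn_ext (dfn_subst tB (dfn_sub MG daE)) => f.
suff -> : fsum f id \o t = fcons (f tt) nu by [].
by apply: funext => j; rewrite /= /t /fcons; case: unlift.
Qed.
End Heirs.

(** * Symmetry *)

Section Symmetry.
Variables (L : language) (P : rel_sym L) (K : Type) (C : structure L).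
Local Notation PC := (Pset P C).
Local Notation dfn := (@dfn L C _).
Local Notation F := {n & formula L n}.
Hypothesis hK : strongly_inaccessible K.
Hypothesis sF : sm K [set: F].
Hypothesis Csat : saturated K C.

(** Finitely many conditions merge into one formula that [c] satisfies for all parameters from [M];
    its solvability therefore holds for all parameters. *)
Lemma ext_exists (M : set C) r (c : 'I_r -> C) A : TV M -> definable M c -> M `<=` A ->
  sm K A -> exists c', ext M c A c'.
Proof.
move=> tv dc MA sA.
have empty (B : set C) : exists h : 'I_0 -> C, range h `<=` B.
  by exists (fun i : 'I_0 => match i with Ordinal _ h => False_rect _ (notF h) end) => d [[]].
have [D [k [E [alpha [h [dE da aP hA ->]]]]]|l lG|c' c'P] := @saturation L K C Csat r A
  [set D | exists k (E : ('I_r -> C) -> ('I_k -> C) -> Prop) (alpha : ('I_k -> C) -> Prop) h,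
    [/\ dfn2 M E, dfn M alpha, forall h, range h `<=` M -> (E c h <-> alpha h),
        range h `<=` A & D = fun y => E y h <-> alpha h]] sA.
- apply: dfn_iff; last exact: dfn_const.
  exact: dfn2_right (dfn2_sub MA dE) hA.
- suff [k [E [h [dE hA EP El]]]] : exists k (E : ('I_r -> C) -> ('I_k -> C) -> Prop) h,
      [/\ dfn2 M E, range h `<=` A, forall g, range g `<=` M -> E c g
        & forall y, E y h -> all_of (fun D => D y) l].
    have [y Ey] : exists y, E y h.
      move: h {hA El}; apply: (TV_all tv (D := fun h => exists y, E y h)).
        exact: (dfn_exv (D := E) dE).
      by move=> g gM; exists c; exact: EP.
    by exists y; exact: El.
  elim: l lG => [|D l IH] /=.
    move=> _; have [h hA] := empty A.
    by exists 0, (fun _ _ => True), h; split=> //; exact: dfn_true.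
  move=> [[k1 [E1 [alpha [h1 [dE1 da aP h1A ->]]]]] /IH[k [E [h [dE hA EP El]]]]].
  pose lh (g : 'I_(k1 + k) -> C) (i : 'I_k1) := g (lshift k i).
  pose rh (g : 'I_(k1 + k) -> C) (i : 'I_k) := g (rshift k1 i).
  have lE : lh (fcat h1 h) = h1 by apply: funext => i; rewrite /lh fcat_lshift.
  have rE : rh (fcat h1 h) = h by apply: funext => i; rewrite /rh fcat_rshift.
  exists (k1 + k), (fun y g => (E1 y (lh g) <-> alpha (lh g)) /\ E y (rh g)), (fcat h1 h).
  split.
  + apply: dfn_and; last exact: (dfn_var (fun x : 'I_r + 'I_k => match x with
      inl i => inl i | inr j => inr (rshift k1 j) end) dE).
    apply: dfn_iff; first exact: (dfn_var (fun x : 'I_r + 'I_k1 => match x with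
      inl i => inl i | inr j => inr (lshift k j) end) dE1).
    exact: (dfn_var (fun i => inr (lshift k i)) da).
  + exact: range_fcat.
  + move=> g gM; split; first by apply: aP => _ [i _ <-]; apply: gM; exists (lshift k i).
    by apply: EP => _ [i _ <-]; apply: gM; exists (rshift k1 i).
  + by move=> y; rewrite lE rE => -[E1y /El].
exists c' => k E alpha dE da aP h hA.
by have /= := c'P (fun y => E y h <-> alpha h); apply; exists k, E, alpha, h.
Qed.

Hypothesis H2 : hypothesis_H2 P C.
Hypothesis H3 : hypothesis_H3 P K C.
Variables (J : Type) (lt : J -> J -> Prop).
Hypothesis wo : strict_wo lt.
Hypothesis sI : sm K [set: J].
Hypothesis Ine : exists i : J, True.
Hypothesis Ibound : forall h : F -> J, exists i, forall f, lt (h f) i.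
Local Notation special := (@special L K C J lt).

Lemma special_TV (N : set C) : special N -> TV N.
Proof. by move=> [A lA]; exact: (ladder_TV Ine Ibound lA). Qed.

Lemma special_sm (N : set C) : special N -> sm K N.
Proof. by move=> [A lA]; exact: (ladder_sm hK sI lA). Qed.

Lemma comp_definable (N : set C) r (c : 'I_r -> C) : TV N -> comp P N (N `|` range c) -> definable N c.
Proof.
move=> tv cN k psi.
pose ph (x : 'I_r -> C) (m : 'I_k -> C) : Prop := fsat psi (fcat x m).
have dph : dfn2 set0 ph := dfn2_fsat psi set0.
have [w nw] := rank_bounded hK sF Csat dph wo sI Ine Ibound H3.
have [alpha da aP] := definable_type_of dph tv cN nw.
by exists alpha.
Qed.

(** * A failure of symmetry makes all ranks infinite *)

Section Claim.
Variables (M : set C) (n k : nat) (a : 'I_n -> C) (b : 'I_k -> C).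
Hypothesis tvM : TV M.
Hypothesis ca : comp P M (M `|` range a).
Hypothesis cb : comp P M (M `|` range b).
Hypothesis heir : ext M b (M `|` range a) b.
Variables (ph : ('I_n -> C) -> ('I_k -> C) -> Prop) (alpha : ('I_k -> C) -> Prop).
Hypothesis dph : dfn2 set0 ph.
Hypothesis dalpha : dfn M alpha.
Hypothesis alphaP : forall m, range m `<=` M -> (ph a m <-> alpha m).
Hypothesis phab : ph a b.
Hypothesis nalpha : ~ alpha b.

Let da : definable M a := comp_definable tvM ca.
Let db : definable M b := comp_definable tvM cb.

(** The induction runs over all data at once: a question adds its parameters and answer to [e]; a
    splitting adds [b1] and takes the negative half to a larger model. *)
Lemma rank_large w : forall N r (e : 'I_r -> C) a'
    (theta : ('I_n -> C) -> ('I_r -> C) -> Prop),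
  special N -> M `<=` N -> ext M a N a' -> comp P N (N `|` range e) ->
  ext N e (N `|` range a') e -> dfn2 N theta -> theta a' e ->
  rank P ph w (theta^~ e).
Proof.
elim: w => [|[q|] w IH] N r e a' theta spN MN exta ce exte dth tha.
- by exists a'.
- have tvN := special_TV spN; have de := comp_definable tvN ce.
  split; first exact: IH exte dth tha.
  move=> Pne nu; apply: contrapT => nd.
  (* Having no answer is a condition on [e] and [nu] over [N], so a bad [nu] can be exchanged for a
     bad [nu0] that keeps [N] with [e] and [nu0] complete. *)
  pose rho (y : 'I_r -> C) (nu : 'I_(q_size q) -> C) := ~ exists d, PC d /\
    rank P ph w (fun x => theta x y /\ answer P (fun z x => q_body q z x nu) d x).
  have drho : dfn2 N rho.
    apply: dfn_not.
    apply: (dfn_ex (D := fun d g => PC d /\ rank P ph w (fun x => theta x (g \o inl) /\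
      answer P (fun z x => q_body q z x (g \o inr)) d x))).
    apply: dfn_and; first exact: dfn_P.
    apply: (@dfn_rank L P C n k ph dph _ _ _ (fun x g => theta x (g \o some \o inl) /\
      answer P (fun z x => q_body q z x (g \o some \o inr)) (g None) x)).
    apply: dfn_and.
      exact: (dfn_var (fun x : 'I_n + 'I_r => match x with
        inl i => inl i | inr j => inr (Some (inl j)) end) dth).
    exact: (@dfn_answer_question L P C n (option ('I_r + 'I_(q_size q))) N q None
      (fun j => Some (inr j))).
  have [||nu0 rho0 ce0] := special_extend hK sF Csat H2 wo sI Ine Ibound (rho := rho e)
    spN ce de.
  + by apply: dfn2_left; [exact: dfn2_sub drho => c; left | move=> c; right].
  + by exists nu => -[d [Pd rd]]; apply: nd; exists d.
  have de0 := comp_definable tvN ce0.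
  have sNa : sm K (N `|` range a').
    by apply: (sm_setU hK); [exact: special_sm | exact: (sm_range_ord hK)].
  have NNa : N `<=` N `|` range a' := @subsetUl _ _ _.
  (* A copy of [e] with [nu0], independent of [a']. Its first part relates to [a'] as [e] does, so
     [theta] survives; completeness passes to [N] with [a'] and [e3]. *)
  have [e3 exte3] := ext_exists tvN de0 NNa sNa.
  pose s := q_size q.
  pose e' (i : 'I_r) := e3 (lshift s i).
  pose nu' (i : 'I_s) := e3 (rshift r i).
  have exte' : ext N e (N `|` range a') e'.
    have := ext_proj exte3.
    by rewrite (_ : (fun i => fcat e nu0 (lshift s i)) = e) //; apply: funext => i;
      rewrite fcat_lshift.
  have a'Na : range a' `<=` N `|` range a' := @subsetUr _ _ _.
  have tha' : theta a' e'.
    have [at_ dat atP] := definableE de (dfn2_swap dth).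
    by apply/(exte' _ _ _ (dfn2_swap dth) dat atP a' a'Na)/(exte _ _ _ (dfn2_swap dth) dat atP a' a'Na).
  have rho' : rho e' nu'.
    have dT : dfn N (fun y : 'I_(r + s) -> C =>
        rho (fun i => y (lshift s i)) (fun i => y (rshift r i))).
      exact: (dfn_var (fun x : 'I_r + 'I_s => match x with
        inl i => lshift s i | inr i => rshift r i end) drho).
    apply/(ext_type de0 exte3 NNa dT).
    rewrite (_ : (fun i => fcat e nu0 (lshift s i)) = e); last first.
      by apply: funext => i; rewrite fcat_lshift.
    rewrite (_ : (fun i => fcat e nu0 (rshift r i)) = nu0) //.
    by apply: funext => i; rewrite fcat_rshift.
  have cNa' : comp P N (N `|` range a').
    exact: (ext_comp da ca tvM exta MN (@subset_refl _ N) (@subset_refl _ N) (TV_comp tvN)).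
  have c3 : comp P N ((N `|` range a') `|` range e3).
    exact: (ext_comp de0 ce0 tvN exte3 NNa (@subset_refl _ _) NNa cNa').
  have nu'3 : range nu' `<=` (N `|` range a') `|` range e3.
    by move=> c [i _ <-]; right; exists (rshift r i).
  (* The answer is read off at the point [a']. As it lies in [N], adding it to [e3] preserves
     independence from [a']. *)
  have [||d [Pd Nd] Ad] := c3 (fun d => answer P (fun z x => q_body q z x nu') d a').
  + apply: (dfn_glue (dfn_answer P tt (dfn_question_param nu'3)) (@subset_refl _ _)).
    by move=> c [i _ <-]; left; right; exists i.
  + have [[z Pz qz]|nz] := pselect (exists2 z, PC z & q_body q z a' nu').
      by exists z.
    by case: Pne => p Pp; exists p => // z; case: nz.
  apply: rho'; exists d; split=> //.
  have [d3 ext3] := ext_tower de0 exte3 (@subset_refl _ N) NNa tvN.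
  have dN : range (fun _ : 'I_1 => d) `<=` N by move=> c [i _ <-].
  have [dd extd] := ext_inside tvN NNa dN.
  have [d4 ext4] := ext_pair tvN NNa (@subset_refl _ _) (subset_trans dN NNa) dd extd d3 ext3.
  have := IH N _ (fcat e3 (fun _ : 'I_1 => d)) a' (fun x y =>
    theta x (fun i => y (lshift 1 (lshift s i))) /\
    answer P (fun z x => q_body q z x (fun i => y (lshift 1 (rshift r i)))) (y (rshift (r + s) ord0)) x)
    spN MN exta _ ext4.
  have E1 : (fun i => fcat e3 (fun _ : 'I_1 => d) (lshift 1 (lshift s i))) = e'.
    by apply: funext => i; rewrite fcat_lshift.
  have E2 : (fun i => fcat e3 (fun _ : 'I_1 => d) (lshift 1 (rshift r i))) = nu'.
    by apply: funext => i; rewrite fcat_lshift.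
  rewrite E1 E2 fcat_rshift; apply => //.
  + apply: comp_sub c3 => c [Nc|[i _ <-]]; first by left; left.
    by rewrite /fcat; case: fintype.split => j; [right; exists j | left; left].
  + apply: dfn_and.
      exact: (dfn_var (fun x : 'I_n + 'I_r => match x with
        inl i => inl i | inr j => inr (lshift 1 (lshift s j)) end) dth).
    exact: (@dfn_answer_question L P C n 'I_(r + s + 1) N q (rshift (r + s) ord0)
      (fun j => lshift 1 (rshift r j))).
have tvN := special_TV spN; have de := comp_definable tvN ce.
have NNa : N `<=` N `|` range a' := @subsetUl _ _ _.
have MNa : M `<=` N `|` range a' := subset_trans MN NNa.
have a'Na : range a' `<=` N `|` range a' := @subsetUr _ _ _.
have sNa : sm K (N `|` range a').
  by apply: (sm_setU hK); [exact: special_sm | exact: (sm_range_ord hK)].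
have [b1 extb1] := ext_exists tvM db MNa sNa.
have [N1 spN1 N1sub] := special_exists hK sF wo sI Ine
  (sm_setU hK sNa (sm_range_ord hK (g := b1))).
have NaN1 : N `|` range a' `<=` N1 by apply: subset_trans N1sub; exact: subsetUl.
have b1N1 : range b1 `<=` N1 by apply: subset_trans N1sub; exact: subsetUr.
have NN1 : N `<=` N1 := subset_trans NNa NaN1.
have MN1 : M `<=` N1 := subset_trans MN NN1.
have tvN1 := special_TV spN1.
have [a1 exta1] := ext_exists tvM da MN1 (special_sm spN1).
have N1a1 : N1 `<=` N1 `|` range a1 := @subsetUl _ _ _.
have a1N1 : range a1 `<=` N1 `|` range a1 := @subsetUr _ _ _.
have sN1a : sm K (N1 `|` range a1).
  by apply: (sm_setU hK); [exact: special_sm | exact: (sm_range_ord hK)].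
have NN1a : N `<=` N1 `|` range a1 := subset_trans NN1 N1a1.
have [e1 exte1] := ext_exists tvN de NN1a sN1a.
(* The rank of [theta] at [e] depends only on the type of [e] over [N], so [e1] may replace [e]. *)
have dR : dfn N (fun y => rank P ph (None :: w) (theta^~ y)).
  exact: (@dfn_rank L P C n k ph dph _ _ (None :: w) theta dth).
apply/(ext_type de exte1 NN1a dR).
have [tau dtau tauP] := definableE de (dfn2_swap dth).
have tha1 : theta a' e1 /\ theta a1 e1.
  have ta' : tau a' by apply/(exte _ _ _ (dfn2_swap dth) dtau tauP a' a'Na).
  have ta1 : tau a1 by apply/(ext_agree da exta1 exta NN1 (@subset_refl _ N) dtau).
  split; apply/(exte1 _ _ _ (dfn2_swap dth) dtau tauP) => //.
  by apply: subset_trans N1a1; exact: subset_trans NaN1.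
(* By [heir], the scheme of [b] accepts [a], hence also [a'], which has the same type over [M]. *)
have pha'b1 : ph a' b1.
  have dphM := dfn2_sub (@sub0set _ M) (dfn2_swap dph).
  have [beta dbeta betaP] := definableE db dphM.
  apply/(extb1 _ _ _ dphM dbeta betaP a' a'Na).
  have ba : beta a by apply/(heir dphM dbeta betaP (@subsetUr _ _ _)).
  exact/(ext_type da exta MN dbeta).
have npha1b1 : ~ ph a1 b1.
  have dphM := dfn2_sub (@sub0set _ M) dph.
  move=> /(exta1 _ _ _ dphM dalpha alphaP b1 b1N1) ab1; apply: nalpha.
  exact/(ext_type db extb1 MNa dalpha).
have exte1N1 : ext N e N1 e1 := ext_sub N1a1 exte1.
exists b1; split.
(* The positive half stays over [N], the model over which [a'] is independent; [b1] is independent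
   of [a'] over [N], and [e1] of both. *)
- have [db1 extb1'] := ext_tower db extb1 MN NNa tvN.
  have [_ ext2] := ext_pair tvN NNa NaN1 b1N1 db1 extb1' de exte1N1.
  have cb1 : comp P N (N `|` range b1).
    exact: (ext_comp db cb tvM (ext_sub NNa extb1) MN (@subset_refl _ N) (@subset_refl _ N) (TV_comp tvN)).
  have c2 : comp P N ((N `|` range b1) `|` range e1).
    apply: (ext_comp de ce tvN exte1N1 (@subsetUl _ _ _) _ NN1 cb1).
    by move=> c [/NN1|/b1N1].
  have := IH N _ (fcat e1 b1) a' (fun x y =>
    theta x (fun i => y (lshift k i)) /\ ph x (fun i => y (rshift r i))) spN MN exta _ ext2.
  rewrite (_ : (fun i => fcat e1 b1 (lshift k i)) = e1); last first.
    by apply: funext => i; rewrite fcat_lshift.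
  rewrite (_ : (fun i => fcat e1 b1 (rshift r i)) = b1); last first.
    by apply: funext => i; rewrite fcat_rshift.
  apply; last by case: tha1.
    apply: comp_sub c2 => c [Nc|[i _ <-]]; first by left; left.
    by rewrite /fcat; case: fintype.split => j; [right; exists j | left; right; exists j].
  apply: dfn_and.
    exact: (dfn_var (fun x : 'I_n + 'I_r => match x with
      inl i => inl i | inr j => inr (lshift k j) end) dth).
  exact: (dfn_var (fun x : 'I_n + 'I_k => match x with
      inl i => inl i | inr j => inr (rshift r j) end) (dfn2_sub (@sub0set _ N) dph)).
(* The negative half is taken over [N1], where [b1] is a tuple of the model and [a1] is the
   independent point. *)
- have [de1 exte1'] := ext_tower de exte1 NN1 N1a1 tvN1.
  have [dbb extbb] := ext_inside tvN1 N1a1 b1N1.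
  have [_ ext2] := ext_pair tvN1 N1a1 (@subset_refl _ _) (subset_trans b1N1 N1a1)
    dbb extbb de1 exte1'.
  have c1 : comp P N1 (N1 `|` range e1).
    exact: (ext_comp de ce tvN exte1N1 NN1 (@subset_refl _ N1) (@subset_refl _ N1) (TV_comp tvN1)).
  have := IH N1 _ (fcat e1 b1) a1 (fun x y =>
    theta x (fun i => y (lshift k i)) /\ ~ ph x (fun i => y (rshift r i))) spN1 MN1 exta1 _ ext2.
  rewrite (_ : (fun i => fcat e1 b1 (lshift k i)) = e1); last first.
    by apply: funext => i; rewrite fcat_lshift.
  rewrite (_ : (fun i => fcat e1 b1 (rshift r i)) = b1); last first.
    by apply: funext => i; rewrite fcat_rshift.
  apply; last by case: tha1.
    apply: comp_sub c1 => c [Nc|[i _ <-]]; first by left.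
    by rewrite /fcat; case: fintype.split => j; [right; exists j | left; apply: b1N1; exists j].
  apply: dfn_and.
    exact: (dfn_var (fun x : 'I_n + 'I_r => match x with
      inl i => inl i | inr j => inr (lshift k j) end) (dfn2_sub NN1 dth)).
  apply: dfn_not; exact: (dfn_var (fun x : 'I_n + 'I_k => match x with
      inl i => inl i | inr j => inr (rshift r j) end) (dfn2_sub (@sub0set _ N1) dph)).
Qed.

Lemma asymmetric_instance_absurd : sm K M -> False.
Proof.
move=> sM; have [w nw] := rank_bounded hK sF Csat dph wo sI Ine Ibound H3; apply: nw.
have [N spN MN] := special_exists hK sF wo sI Ine sM.
have tvN := special_TV spN.
have [a' exta] := ext_exists tvM da MN (special_sm spN).
pose e (i : 'I_0) : C := match i with Ordinal _ h => False_rect _ (notF h) end.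
have eN : range e `<=` N by move=> c [[]].
have [_ exte] := ext_inside tvN (@subsetUl _ N (range a')) eN.
apply: (rank_large w (theta := fun _ _ => True) spN MN exta _ exte) => //.
  by apply: comp_sub (TV_comp tvN) => c [|/eN].
exact: dfn_true.
Qed.
End Claim.

(** Completeness and independence pass to every tuple [h] from [M] and [b], so the claim applies
    with [h] for [b]. The two directions of the equivalence are its cases for [psi] and for the
    negation of [psi]. *)
Lemma heir_symmetry (M : set C) n m (a : 'I_n -> C) (b : 'I_m -> C) : sm K M -> TV M ->
  comp P M (M `|` (range a `|` range b)) ->
  ext M b (M `|` range a) b -> ext M a (M `|` range b) a.
Proof.
move=> sM tv cab heir.
have ca : comp P M (M `|` range a) by apply: comp_sub cab; apply: setUS; exact: subsetUl.
apply: ext_formulas => // k psi.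
have [alpha da aP] := comp_definable tv ca psi.
exists alpha => //; split=> // h hb.
have ch : comp P M (M `|` range h).
  by apply: comp_sub cab => c [|/hb[|]]; [left | left | right; right].
have heirh := ext_subtuple hb heir.
have dpsi : dfn2 set0 (fun (x : 'I_n -> C) (y : 'I_k -> C) => fsat psi (fcat x y)) := dfn2_fsat psi _.
split=> [ph|ah]; apply: contrapT => nh.
  exact: (asymmetric_instance_absurd tv ca ch heirh dpsi da aP ph nh sM).
have dnpsi : dfn2 set0 (fun (x : 'I_n -> C) (y : 'I_k -> C) => ~ fsat psi (fcat x y)).
  exact: dfn_not dpsi.
apply: (asymmetric_instance_absurd tv ca ch heirh dnpsi (dfn_not da) _ nh _ sM) => // m' m'M.
by rewrite aP.
Qed.
End Symmetry.

Unset Implicit Arguments.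

(** * Translation into stationarizations *)

Lemma elementary_subset_t (L : language) (C : structure L) (M B : set C) :
  TV M -> M `<=` B -> subset_t M B.
Proof.
move=> tv MB; split=> // n k psi b a aM _ sba.
have [|h hM sh] := tv _ _ (dfn2_right (dfn2_fsat psi M) aM).
  by exists (tnth b); rewrite -tnth_cat -sat_fsat.
exists [tuple h i | i < n]; first by rewrite /tuple_in tnth_mktupleE.
by rewrite sat_fsat tnth_cat tnth_mktupleE.
Qed.

Lemma defines_tpP (L : language) (C : structure L) (D : set C) n (c : n.-tuple C) k
    (psi : formula L (n + k)) (Psi : pformula C k) :
  defines D (tp c D) psi Psi <-> forall h, range h `<=` D ->
    (fsat psi (fcat (tnth c) h) <-> psat Psi [tuple h i | i < k]).
Proof.
split=> H.
  move=> h hD; have hD' : tuple_in [tuple h i | i < k] D by rewrite /tuple_in tnth_mktupleE.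
  rewrite -(H _ hD') /tp /= /psat /= sat_fsat tnth_cat tnth_mktupleE.
  by split=> [|[]].
move=> b bD; have <- : [tuple tnth b i | i < k] = b.
  by apply: eq_from_tnth => i; rewrite tnth_mktuple.
rewrite -(H (tnth b) bD) /tp /= /psat /= sat_fsat tnth_cat !tnth_mktupleE.
by split=> [[]|s]; last by split=> //; rewrite /tuple_in tnth_mktupleE.
Qed.

Theorem theorem25 (L : language) (P : rel_sym L) (hP : arity P = 1)
    (T : set (sentence L)) (hT : complete_theory T)
    (hQE : quantifier_elimination T)
    (K : Type) (C : structure L) (hC : monster_model T K C)
    (H1 : hypothesis_H1 P C) (H2 : hypothesis_H2 P C)
    (H3 : hypothesis_H3 P K C)
    (M : set C) (hM : model_in K M)
    (n m : nat) (a : n.-tuple C) (b : m.-tuple C)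
    (hab : S_star P M (tp (cat_tuple a b) M)) :
  stationarization P K M (M `|` range (tnth a))
    (tp b M) (tp b (M `|` range (tnth a))) ->
  stationarization P K M (M `|` range (tnth b))
    (tp a M) (tp a (M `|` range (tnth b))).
Proof.
move=> [_ _ _ _ stat].
have [_ inac Csat _] := hC; have hK := inaccessible_strongly inac.
have sF : sm K [set: {n & formula L n}] by have [/small_sm] := inac.
have [J [lt [wo sJ Jne Jbound]]] := ladder_exists hK sF.
have [/small_sm sM /TV_elementary tvM] := hM.
have cab : comp P M (M `|` (range (tnth a) `|` range (tnth b))).
  apply: comp_sub (S_star_comp hab); apply: setUS => c.
  rewrite tnth_cat => -[[i _ <-]|[i _ <-]].
    by exists (lshift m i); rewrite ?fcat_lshift.
  by exists (rshift n i); rewrite ?fcat_rshift.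
have ca : comp P M (M `|` range (tnth a)).
  by apply: comp_sub cab; apply: setUS; exact: subsetUl.
have heir : ext M (tnth b) (M `|` range (tnth a)) (tnth b).
  apply: ext_formulas => // k psi; have [Psi [PsiM d1 d2]] := stat k psi.
  exists (fun h => psat Psi [tuple h i | i < k]); first exact: pformula_dfn.
  by split; apply/defines_tpP.
have coheir := heir_symmetry hK sF Csat H2 H3 wo sJ Jne Jbound sM tvM cab heir.
split.
- exact: H3.
- exact: comp_S_star.
- exact: elementary_subset_t.
- by exists a.
(* The definition is produced over [M] alone; [coheir] shows that it remains correct over [M] with
   [b]. *)
move=> k psi; have [alpha dalpha alphaP] :=
  comp_definable hK sF Csat H3 wo sJ Jne Jbound tvM ca psi.
have [Psi PsiM alphaPsi] := dfn_pformula dalpha.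
have alphaPsi' h : alpha h <-> psat Psi [tuple h i | i < k].
  by rewrite -alphaPsi tnth_mktupleE.
exists Psi; split=> //; apply/defines_tpP => h hM'; rewrite -alphaPsi'.
  exact: alphaP.
exact: (coheir _ _ _ (dfn2_fsat psi M) dalpha alphaP).
Qed.
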